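(* Let $G$ be a finitely generated (discrete) group that is relatively hyperbolic with respect to a finite collection $\mathcal P$ of infinite subgroups. Then for some $\lambda\in(0,1)$ there exists a continuous $G$-equivariant map from the Floyd boundary $\partial_\lambda G$ to the Bowditch boundary of $G$ with respect to $\mathcal P$.
   Context: Floyd boundary. Fix a finite generating set $S$ of $G$ and its Cayley graph, with graph metric $\mathsf d$, on which $G$ acts by left multiplication. For $\lambda\in(0,1)$ let $\delta_\lambda$ be the path metric on $G$ obtained by giving each edge $e$ length $\lambda^{\mathsf d(1,e)}$. The Floyd completion is the Cauchy completion of $(G,\delta_\lambda)$; the action of $G$ on itself extends to it by homeomorphisms, and $\partial_\lambda G$ is the complement of $G$ in it. Relative hyperbolicity. Graphs have no loops or multiple edges. A graph is fine if each set of arcs (simple paths) of bounded length with fixed endpoints is finite. An action of $G$ on a connected graph $\Gamma$ is relatively hyperbolic if $\Gamma$ is $\delta$-hyperbolic (for some $\delta$) and fine, edge stabilizers are finite, $\Gamma^1/G$ is finite ($\Gamma^1$ is the set of edges), and no vertex is fixed by the whole $G$. $G$ is relatively hyperbolic with respect to $\mathcal P$ if it has such an action for which $\mathcal P$ is a set of representatives of the conjugacy classes (orbits) of the stabilizers of the vertices of infinite degree. Bowditch completion and boundary. Take such an action $G\curvearrowright\Gamma$. For an edge $e$ let $\mathbf u_e$ be the set of unordered pairs $\{x,y\}$ of vertices such that no geodesic segment of $\Gamma$ joining $x$ and $y$ passes through $e$. The filter on the set of unordered pairs of vertices generated by $\{\mathbf u_e\}_{e\in\Gamma^1}$ is a $G$-invariant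 uniformity on the vertex set $\Gamma^0$; the completion $B$ of $\Gamma^0$ with respect to it is a compact Hausdorff space (the Bowditch completion) on which $G$ acts by homeomorphisms, properly on the space of three-point subsets. The Bowditch boundary of $G$ with respect to $\mathcal P$ is the limit set of the action $G\curvearrowright B$: the set of $a\in B$ for which there is $r\in B$ such that the cross $(\{r\}\times B)\cup(B\times\{a\})$ lies in the closure of the set of graphs of the maps $x\mapsto gx$, $g\in G$, in the space of closed subsets of $B\times B$ with the Vietoris topology. *)

(* Defs.v *)
From HB Require Import structures.
From mathcomp Require Import all_boot all_order all_algebra.
From mathcomp Require Import all_classical all_reals all_analysis.
Set Implicit Arguments.
Unset Strict Implicit.
Unset Printing Implicit Defensive.
Import Order.TTheory GRing.Theory Num.Theory.
Local Open Scope classical_set_scope.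
Local Open Scope ring_scope.

(* Graphs *)

Record simple_graph (V : choiceType) := SimpleGraph {
  adj :> rel V;
  adj_sym : symmetric adj;
  adj_irr : irreflexive adj }.

Section Graph.
Context {V : choiceType} (Gam : simple_graph V).

(* An edge is the unordered pair of its ends. *)
Definition edges : set (set V) :=
  [set [set ab.1; ab.2] | ab in [set ab : V * V | Gam ab.1 ab.2]].

(* The path with the successive vertices [x :: p] goes from [x] to [y]. *)
Definition walk (x y : V) (p : seq V) : Prop := path Gam x p /\ last x p = y.

Definition connected_graph : Prop :=
  [set: V] !=set0 /\ forall x y, exists p, walk x y p.

(* The default value 0 is taken only when no path joins [x] and [y]. *)
Definition gdist (x y : V) : nat :=
  xget 0%N [set n | (exists2 p, walk x y p & size p = n) /\
                    forall p, walk x y p -> (n <= size p)%N].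

Lemma gdistP x y : (exists p, walk x y p) ->
  (exists2 p, walk x y p & size p = gdist x y) /\
  forall p, walk x y p -> (gdist x y <= size p)%N.
Proof.
move=> [p0 w0].
apply: (@xgetPex _ 0%N [set n | (exists2 p, walk x y p & size p = n) /\
                    forall p, walk x y p -> (n <= size p)%N]).
have : exists n, `[< exists2 p, walk x y p & size p = n >].
  by exists (size p0); apply/asboolP; exists p0.
move=> /ex_minnP[n /asboolP wn nmin]; exists n; split=> // p w.
by apply: nmin; apply/asboolP; exists p.
Qed.

Definition geodesic (x y : V) (p : seq V) : Prop :=
  walk x y p /\ size p = gdist x y.

(* The pairs of consecutive vertices of [x :: p]. *)
Definition steps (x : V) (p : seq V) : seq (V * V) := zip (x :: p) p.

Definition passes_through (x : V) (p : seq V) (e : set V) : Prop :=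
  exists2 ab, ab \in steps x p & [set ab.1; ab.2] = e.

(* Slim triangles: as the corners are arbitrary, it is enough to consider one
   side of each geodesic triangle. *)
Definition hyperbolic (delta : nat) : Prop :=
  forall (x y z : V) (p q r : seq V),
    geodesic x y p -> geodesic y z q -> geodesic x z r ->
    forall w, w \in x :: r ->
    exists2 w', w' \in (x :: p) ++ (y :: q) & (gdist w w' <= delta)%N.

Definition fine : Prop :=
  forall (x y : V) (n : nat),
    finite_set [set p | [/\ walk x y p, uniq (x :: p) & (size p <= n)%N]].

Definition infinite_degree (v : V) : Prop := infinite_set [set w | Gam v w].

End Graph.

(* Groups and actions *)

Definition generates (G : groupType) (S : set G) : Prop :=
  forall H : set G, group_closed [in H] -> S `<=` H -> H = setT.

Definition conjugate (G : groupType) (g : G) (H : set G) : set G :=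
  [set (g * h * g^-1)%g | h in H].

Record group_action (G : groupType) (T : Type) := GroupAction {
  actf :> G -> T -> T;
  act1 : forall x, actf 1%g x = x;
  actM : forall g h x, actf (g * h)%g x = actf g (actf h x) }.

Lemma actK (G : groupType) (T : Type) (a : group_action G T) g :
  cancel (a g) (a g^-1%g).
Proof. by move=> x; rewrite -actM mulVg act1. Qed.

Lemma actKV (G : groupType) (T : Type) (a : group_action G T) g :
  cancel (a g^-1%g) (a g).
Proof. by move=> x; rewrite -actM mulgV act1. Qed.

Record graph_action (G : groupType) (V : choiceType) (Gam : simple_graph V) :=
  GraphAction {
    gact :> group_action G V;
    gact_adj : forall g x y, Gam (gact g x) (gact g y) = Gam x y }.

Section GraphAction.
Context {G : groupType} {V : choiceType} {Gam : simple_graph V}.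
Variable a : graph_action G Gam.

Lemma walk_act g x y p :
  walk Gam x y p -> walk Gam (a g x) (a g y) (map (a g) p).
Proof.
move=> [xp <-]; split; last by rewrite last_map.
by rewrite path_map; apply: sub_path xp => u v /=; rewrite gact_adj.
Qed.

Lemma gdist_act g x y : gdist Gam (a g x) (a g y) = gdist Gam x y.
Proof.
rewrite /gdist; congr xget; apply/seteqP; split=> n /= [[p w <-] m]; split.
- have := walk_act g^-1%g w; rewrite !actK => w'.
  by exists (map (a g^-1%g) p); rewrite ?size_map.
- by move=> q /(walk_act g)/m; rewrite size_map.
- by exists (map (a g) p); [exact: walk_act|rewrite size_map].
- move=> q /(walk_act g^-1%g); rewrite !actK => /m.
  by rewrite size_map.
Qed.

Lemma steps_act g x p :
  steps (a g x) (map (a g) p) =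
  [seq (a g ab.1, a g ab.2) | ab <- steps x p].
Proof. by rewrite /steps; elim: p x => //= y p IH x; rewrite IH. Qed.

Definition stabilizer (v : V) : set G := [set g | a g v = v].

Definition relatively_hyperbolic_action : Prop :=
  [/\ connected_graph Gam, (exists delta, hyperbolic Gam delta) & fine Gam] /\
  [/\ (forall e, edges Gam e -> finite_set [set g | a g @` e = e]),
      finite_set [set [set a g @` e | g in [set: G]] | e in edges Gam]
    & forall v, exists g, a g v <> v].

Definition peripheral_representatives (P : set (set G)) : Prop :=
  (forall H, P H -> exists2 v, infinite_degree Gam v & H = stabilizer v) /\
  (forall v, infinite_degree Gam v ->
     exists! H, P H /\ exists g, H = conjugate g (stabilizer v)).

End GraphAction.

(* Hausdorff completion of a uniformity [U] on [T]: its points are the minimal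
   Cauchy filters (Bourbaki, General Topology, II.3.7). The definitions make
   sense for every filter [U] on [T * T]; they yield the completion when [U] is
   a uniformity. *)

Section Completion.
Context {T : Type}.

Definition cauchy_filter (U : set_system (T * T)) (F : set_system T) : Prop :=
  ProperFilter F /\ forall E, U E -> exists2 A, F A & A `*` A `<=` E.

Definition minimal_cauchy (U : set_system (T * T)) (F : set_system T) : Prop :=
  cauchy_filter U F /\ forall F', cauchy_filter U F' -> F' `<=` F -> F' = F.

Record completion (U : filter_on (T * T)) := CompletionPoint {
  pfilt : set_system T;
  pfiltP : minimal_cauchy U pfilt }.

HB.instance Definition _ (U : filter_on (T * T)) := gen_eqMixin (completion U).
HB.instance Definition _ (U : filter_on (T * T)) :=
  gen_choiceMixin (completion U).

(* The neighbourhood filter of [x], which is the image of [x] in the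
   completion. *)
Definition nbhs_filter (U : set_system (T * T)) (x : T) : set_system T :=
  filter_from U (fun E => [set y | E (x, y)]).

Section Topology.
Variable U : filter_on (T * T).

(* The extension of [E] to the completion. *)
Definition completion_close (E : set (T * T)) (xi eta : completion U) : Prop :=
  exists A, [/\ pfilt xi A, pfilt eta A & A `*` A `<=` E].

Definition completion_open : set_system (completion U) :=
  [set O | forall xi, O xi ->
    exists2 E, (U : set_system (T * T)) E &
      [set eta | completion_close E xi eta] `<=` O].

Let openT : completion_open setT.
Proof. by move=> xi _; exists setT => //; exact: filterT. Qed.

Let openI : setI_closed completion_open.
Proof.
move=> A B oA oB xi [/oA[E UE EA] /oB[E' UE' EB]].
exists (E `&` E'); first exact: filterI.
move=> eta [C [xiC etaC CE]]; split.
  by apply: EA; exists C; split => // z /CE[].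
by apply: EB; exists C; split => // z /CE[].
Qed.

Let open_bigU (I : Type) (f : I -> set (completion U)) :
  (forall i, completion_open (f i)) -> completion_open (\bigcup_i f i).
Proof.
move=> of_ xi [i _ /of_[E UE Ef]]; exists E => // eta /Ef; by exists i.
Qed.

HB.instance Definition _ :=
  isOpenTopological.Build (completion U) openT openI open_bigU.

End Topology.

Definition uniform_action (G : groupType) (U : set_system (T * T))
    (a : group_action G T) : Prop :=
  forall g E, U E -> U [set xy | E (a g xy.1, a g xy.2)].

Section Action.
Context {G : groupType} {U : filter_on (T * T)} {a : group_action G T}.
Hypothesis aU : uniform_action U a.

Let cauchy_act g F : cauchy_filter U F -> cauchy_filter U (fmap (a g) F).
Proof.
move=> [FF FU]; split; first exact: fmap_proper_filter.
move=> E /(aU g) /FU[A FA AE]; exists (a g @` A).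
  by apply: (@filterS _ F _ A) => // x Ax; exists x.
by move=> [u v] /= [[x Ax <-] [y Ay <-]]; exact: (AE (x, y)).
Qed.

Let preimage_actK g A : a g^-1%g @^-1` (a g @^-1` A) = A.
Proof. by apply/seteqP; split => x; rewrite /preimage /= actKV. Qed.

Let preimage_actKV g A : a g @^-1` (a g^-1%g @^-1` A) = A.
Proof. by apply/seteqP; split => x; rewrite /preimage /= actK. Qed.

Let minimal_act g F : minimal_cauchy U F -> minimal_cauchy U (fmap (a g) F).
Proof.
move=> [cF minF]; split; first exact: cauchy_act.
move=> F' cF' F'F.
have <- : fmap (a g^-1%g) F' = F.
  apply: minF; first exact: cauchy_act.
  by move=> A /F'F; rewrite /fmap /mkset preimage_actKV.
by apply/funext => A; rewrite /fmap /mkset preimage_actK.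
Qed.

(* The continuous extension of [a g] to the completion. *)
Definition completion_act (g : G) (xi : completion U) : completion U :=
  CompletionPoint (minimal_act g (pfiltP xi)).

End Action.
End Completion.

(* The Vietoris topology on the space of closed subsets *)

Section Vietoris.
Variable X : topologicalType.

Record closed_subset := ClosedSubset {
  cset : set X;
  csetP : closed cset }.

HB.instance Definition _ := gen_eqMixin closed_subset.
HB.instance Definition _ := gen_choiceMixin closed_subset.

(* The subbase consists of the sets of all [C] included in an open set [i.2],
   and of all [C] meeting an open set [i.2]. *)
Definition vietoris_subbase (i : bool * set X) : set closed_subset :=
  [set C | if i.1 then cset C `<=` i.2 else cset C `&` i.2 !=set0].

HB.instance Definition _ := isSubBaseTopological.Build closed_subset
  [set i : bool * set X | open i.2] vietoris_subbase.

End Vietoris.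

(* The graphs of the maps [a g], and the cross of [r] and [b], are closed when
   [B] is Hausdorff and the maps are continuous. *)
Definition limit_set (G : groupType) (B : topologicalType) (a : G -> B -> B) :
    set B :=
  [set b | exists (r : B) (C : closed_subset (B * B)%type),
     cset C = [set r] `*` setT `|` setT `*` [set b] /\
     closure [set D : closed_subset (B * B)%type |
       exists g, cset D = [set xy | xy.2 = a g xy.1]] C].

(* The Floyd completion and boundary *)

Section Cayley.
Context {G : groupType} (S : set G).

Definition cayley_adj : rel G := fun g h =>
  `[< g <> h /\ exists2 s, S s & h = (g * s)%g \/ g = (h * s)%g >].

Let cayley_sym : symmetric cayley_adj.
Proof.
by move=> g h; apply/asbool_equiv_eq; split=> -[ne [s Ss e]];
  (split; first exact: nesym); exists s => //; case: e; [right|left|right|left].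
Qed.

Let cayley_irr : irreflexive cayley_adj.
Proof. by move=> g; apply/asboolPn => -[]. Qed.

Definition cayley_graph : simple_graph G := SimpleGraph cayley_sym cayley_irr.

Let cayley_adj_mul g x y : cayley_graph (g * x)%g (g * y)%g = cayley_graph x y.
Proof.
apply/asbool_equiv_eq; split=> -[ne [s Ss e]]; split.
- by move=> xy; apply: ne; rewrite xy.
- exists s => //; case: e; rewrite -mulgA => /mulgI; by [left|right].
- by move=> /mulgI.
- by exists s => //; case: e => ->; rewrite mulgA; [left|right].
Qed.

(* The action by left multiplication. *)
Definition cayley_action : graph_action G cayley_graph :=
  @GraphAction G G cayley_graph
    (GroupAction (@mul1g G) (fun g h x => esym (mulgA g h x))) cayley_adj_mul.

End Cayley.

Section Floyd.
Context {R : realType} {G : groupType} (S : set G) (lam : R).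

(* The distance from 1 to an edge is the distance to the nearest of its ends. *)
Definition floyd_length (x : G) (p : seq G) : R :=
  \sum_(ab <- steps x p)
    lam ^+ minn (gdist (cayley_graph S) 1%g ab.1)
                (gdist (cayley_graph S) 1%g ab.2).

Definition floyd_dist (x y : G) : R :=
  inf [set floyd_length x p | p in walk (cayley_graph S) x y].

Definition floyd_entourages : set_system (G * G) :=
  filter_from [set e : R | 0 < e]
    (fun e => [set xy | floyd_dist xy.1 xy.2 < e]).

Lemma floyd_entourages_filter : Filter floyd_entourages.
Proof.
apply: filter_from_filter; first by exists 1 => /=.
move=> e e' /= e0 e0'; exists (Num.min e e') => /=; first by rewrite lt_min e0.
by move=> xy /=; rewrite lt_min => /andP[].
Qed.

Definition floyd_completion : Type :=
  completion (FilterType floyd_entourages floyd_entourages_filter).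

Section FloydAction.
Hypotheses (Sgen : generates S) (lam01 : 0 < lam < 1).

Let linked x y := exists p, walk (cayley_graph S) x y p.

Let linked_trans x y z : linked x y -> linked y z -> linked x z.
Proof.
move=> [p [xp <-]] [q [pq <-]]; exists (p ++ q).
by split; [rewrite cat_path xp|rewrite last_cat].
Qed.

Let linked_sym x y : linked x y -> linked y x.
Proof.
move=> [p [xp <-]]; exists (rev (belast x p)); split.
  rewrite rev_path; apply: sub_path xp => u v.
  by rewrite (adj_sym (cayley_graph S) u v).
by case: p {xp} => //= z p; rewrite rev_cons last_rcons.
Qed.

Let linked_mul g x y : linked x y -> linked (g * x)%g (g * y)%g.
Proof.
move=> [p /(walk_act (cayley_action S) g)] w.
by exists (map (cayley_action S g) p).
Qed.

Let linked_gen s : S s -> linked 1%g s.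
Proof.
move=> Ss; have [->|s1] := eqVneq s 1%g; first by exists [::]; split.
exists [:: s]; split => //=; rewrite andbT; apply/asboolP; split.
  by apply/eqP; rewrite eq_sym.
by exists s => //; left; rewrite mul1g.
Qed.

Let linkedT x y : linked x y.
Proof.
have L1 : [set x | linked 1%g x] = setT.
  apply: Sgen; last exact: linked_gen.
  split; first by rewrite inE; exists [::]; split.
  move=> u v; rewrite !inE /= => lu lv; apply: (linked_trans lu).
  apply: linked_sym.
  by have := linked_mul (u * v^-1)%g lv; rewrite mulg1 -mulgA mulVg mulg1.
have l1 z : linked 1%g z by have : [set: G] z by []; rewrite -L1.
exact: linked_trans (linked_sym (l1 x)) (l1 y).
Qed.

Let gdist_mul g x : (gdist (cayley_graph S) 1%g x <=
  gdist (cayley_graph S) 1%g (g * x)%g + gdist (cayley_graph S) 1%g g^-1%g)%N.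
Proof.
rewrite -(gdist_act (cayley_action S) g^-1%g 1%g (g * x)%g) /=.
rewrite mulg1 mulgA mulVg mul1g.
have [[p [p1 pE] <-] _] := gdistP (linkedT g^-1%g x).
have [[q [q1 qE] <-] _] := gdistP (linkedT 1%g g^-1%g).
have [_] := gdistP (linkedT 1%g x); move=> /(_ (q ++ p)).
rewrite size_cat addnC; apply; split; first by rewrite cat_path q1 qE.
by rewrite last_cat qE.
Qed.

Let floyd_length_ge0 x p : 0 <= floyd_length x p.
Proof.
have /andP[lam0 _] := lam01.
by rewrite /floyd_length sumr_ge0 // => ab _; rewrite exprn_ge0 // ltW.
Qed.

Let floyd_length_mul g x p :
  lam ^+ gdist (cayley_graph S) 1%g g^-1%g *
    floyd_length (g * x)%g (map (cayley_action S g) p) <= floyd_length x p.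
Proof.
have /andP[lam0 lam1] := lam01.
rewrite /floyd_length (steps_act (cayley_action S)) big_map /= mulr_sumr.
apply: ler_sum => -[u v] _ /=; rewrite -exprD.
apply: ler_wiXn2l; rewrite ?ltW //.
rewrite addnC addn_minl leq_min; apply/andP; split.
  exact: leq_trans (geq_minl _ _) (gdist_mul g u).
exact: leq_trans (geq_minr _ _) (gdist_mul g v).
Qed.

Let floyd_dist_mul g x y :
  lam ^+ gdist (cayley_graph S) 1%g g^-1%g *
    floyd_dist (g * x)%g (g * y)%g <= floyd_dist x y.
Proof.
have /andP[lam0 _] := lam01.
apply: lb_le_inf.
  by have [p w] := linkedT x y; exists (floyd_length x p), p.
move=> _ [p w <-]; apply: le_trans (floyd_length_mul g x p).
rewrite ler_pM2l ?exprn_gt0 //; apply: ge_inf.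
  by exists 0 => _ [q _ <-].
exists (map (cayley_action S g) p) => //.
exact: (walk_act (cayley_action S)).
Qed.

Lemma floyd_uniform_action :
  uniform_action floyd_entourages (cayley_action S).
Proof.
have /andP[lam0 _] := lam01.
move=> g E [e /= e0 eE].
have K0 : 0 < lam ^+ gdist (cayley_graph S) 1%g g^-1%g by rewrite exprn_gt0.
exists (lam ^+ gdist (cayley_graph S) 1%g g^-1%g * e) => /=.
  exact: mulr_gt0.
move=> [x y] /= xy; apply: eE => /=.
by rewrite -(ltr_pM2l K0); exact: le_lt_trans (floyd_dist_mul g x y) xy.
Qed.

(* The extension of the left multiplication by [g] to the completion. *)
Definition floyd_act : G -> floyd_completion -> floyd_completion :=
  completion_act (U := FilterType _ floyd_entourages_filter)
    floyd_uniform_action.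

End FloydAction.

Definition floyd_boundary : set floyd_completion :=
  [set xi | forall x, pfilt xi <> nbhs_filter floyd_entourages x].

End Floyd.

Arguments floyd_boundary {R G} S lam _.

(* The Bowditch completion and boundary *)

Section Bowditch.
Context {V : choiceType} (Gam : simple_graph V).

(* The set u_e, as a symmetric set of ordered pairs. It contains the diagonal,
   as a one-point path passes through no edge. *)
Definition unseparated (e : set V) : set (V * V) :=
  [set xy | forall p, geodesic Gam xy.1 xy.2 p -> ~ passes_through xy.1 p e].

Definition bowditch_entourages : set_system (V * V) :=
  smallest (@Filter (V * V)) (unseparated @` edges Gam).

Lemma bowditch_entourages_filter : Filter bowditch_entourages.
Proof. exact: smallest_filter_filter. Qed.

Definition bowditch_completion : Type :=
  completion (FilterType bowditch_entourages bowditch_entourages_filter).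

Section BowditchAction.
Context {G : groupType} (a : graph_action G Gam).

Let unseparated_act g e :
  unseparated ((a g^-1%g) @` e) `<=`
  [set xy | unseparated e (a g xy.1, a g xy.2)].
Proof.
move=> [x y] /= sep p [w sp] [[u v] /= uv uve].
have w' := walk_act a g^-1%g w; rewrite !actK in w'.
apply: (sep (map (a g^-1%g) p)).
  by split=> //; rewrite size_map sp gdist_act.
exists (a g^-1%g u, a g^-1%g v); last by rewrite -uve image_setU !image_set1.
by rewrite -{1}[x](actK a g) steps_act; apply/mapP; exists (u, v).
Qed.

Let edges_act g e : edges Gam e -> edges Gam (a g @` e).
Proof.
move=> [[x y] /= xy <-]; exists (a g x, a g y) => /=; first by rewrite gact_adj.
by rewrite image_setU !image_set1.
Qed.

Lemma bowditch_uniform_action : uniform_action bowditch_entourages a.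
Proof.
move=> g; pose X := [set E : set (V * V) |
  bowditch_entourages [set xy | E (a g xy.1, a g xy.2)]].
have FB := bowditch_entourages_filter.
have FX : Filter X.
  split; rewrite /X /=; first exact: filterT.
    by move=> A B FA FB'; exact: filterI FA FB'.
  move=> A B AB FA; refine (filterS _ FA); by move=> xy; exact: AB.
suff : bowditch_entourages `<=` X by apply.
apply: smallest_sub => // _ [e Ee <-].
apply: filterS (unseparated_act (g := g) (e := e)) _.
by apply: sub_gen_smallest; exists (a g^-1%g @` e) => //; exact: edges_act.
Qed.

Definition bowditch_act : G -> bowditch_completion -> bowditch_completion :=
  completion_act (U := FilterType _ bowditch_entourages_filter)
    bowditch_uniform_action.

Definition bowditch_boundary : set bowditch_completion :=
  limit_set bowditch_act.

End BowditchAction.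
End Bowditch.

(* Main.v *)
Require Import Defs.
From mathcomp Require Import finmap zify ring lra.
From mathcomp Require Import all_boot all_order all_algebra.
From mathcomp Require Import all_classical all_reals all_analysis.
Import Order.TTheory GRing.Theory Num.Theory.
Local Open Scope classical_set_scope.
Local Open Scope ring_scope.

(** The map is the continuous extension of an orbit map [g |-> g v] of [G] on the
    vertices of the graph, from the Floyd metric to the uniformity generated by
    the sets [u_e].

    Uniform continuity ([floyd_uniform]) rests on the triangle property
    [cuts_triangle]: for an edge [e] there is a finite set of edges such that, if
    a geodesic from [x] to [y] passes through [e], then for every [z] a geodesic
    from [x] to [z] or from [z] to [y] passes through one of them. By equivariance,
    the new edge is at a bounded distance from [e] when edges are measured by word
    length. Let now a path of the Cayley graph join [g] to [h], and let [e] lie on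
    a geodesic from [g v] to [h v]. Halving the Floyd length of the path over and
    over, one follows [e] to a single edge of the path, and moves by a bounded
    amount at each step. If [lam] is close enough to 1, the Floyd lengths of edges
    decay more slowly than the length of the part that remains, so the length of
    the path is bounded below in terms of [e] ([floyd_length_lower_bound]). A
    uniformly continuous map extends to completions, and the extension of an
    equivariant map is equivariant.

    A boundary point [xi] is a Cauchy filter on [G] that converges to no element of
    [G], so an ultrafilter finer than [xi] contains no finite set. Along it, [g v]
    converges to the image [b] of [xi], and [g^-1 v] to some [r], because the
    Bowditch completion is compact. Except for finitely many [g], the element [g]
    sends every vertex that is not close to [g^-1 v] to a vertex close to [g v]
    ([finite_linked], [escaping_dynamics]). Hence the graphs of the maps given by
    [g] converge, in the Vietoris topology, to the cross of [r] and [b], and [b]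
    belongs to the limit set ([north_south_limit_set]). *)

Set Implicit Arguments.
Unset Strict Implicit.
Unset Printing Implicit Defensive.

(** * Walks and distances in a connected graph *)

Section Walks.
Context {V : choiceType} {Gam : simple_graph V}.
Local Open Scope nat_scope.
Implicit Types (x y z u v w : V) (p q : seq V).

Lemma walk0 x : walk Gam x x [::].
Proof. by []. Qed.

Lemma walk_cat x y z p q :
  walk Gam x y p -> walk Gam y z q -> walk Gam x z (p ++ q).
Proof.
move=> [xp <-] [yq <-]; split; first by rewrite cat_path xp.
by rewrite last_cat.
Qed.

Lemma walk_rev x y p : walk Gam x y p -> walk Gam y x (rev (belast x p)).
Proof.
move=> [xp <-]; split.
  rewrite rev_path; apply: sub_path xp => u v.
  by rewrite (adj_sym Gam u v).
by case: p {xp} => //= z p; rewrite rev_cons last_rcons.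
Qed.

Lemma steps_cons x y p : steps x (y :: p) = (x, y) :: steps y p.
Proof. by []. Qed.

Lemma mem_stepsP x p u v : (u, v) \in steps x p ->
  exists p1 p2, p = p1 ++ v :: p2 /\ last x p1 = u.
Proof.
elim: p x => [//|y p IH] x; rewrite steps_cons inE => /orP[/eqP[-> ->]|].
  by exists [::], p.
by move=> /IH[p1 [p2 [-> <-]]]; exists (y :: p1), p2.
Qed.

Lemma steps_cat x p q : steps x (p ++ q) = steps x p ++ steps (last x p) q.
Proof. by elim: p x => [|y p IH] x //; rewrite cat_cons !steps_cons IH. Qed.

Lemma path_steps (e : rel V) x p :
  path e x p = all (fun ab => e ab.1 ab.2) (steps x p).
Proof. by elim: p x => // y p IH x; rewrite steps_cons /= IH. Qed.

Hypothesis Gam_conn : connected_graph Gam.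
Local Notation d := (gdist Gam).

Lemma geodesic_exists x y : exists p, geodesic Gam x y p.
Proof.
have [_ /(_ x y) c] := Gam_conn.
by have [[p w s] _] := gdistP c; exists p.
Qed.

Lemma gdist_le x y p : walk Gam x y p -> d x y <= size p.
Proof.
by move=> w; have [_] := gdistP (ex_intro (walk Gam x y) p w); exact.
Qed.

Lemma gdistxx x : d x x = 0.
Proof. by apply/eqP; rewrite -leqn0; exact: gdist_le (walk0 x). Qed.

Lemma gdistC x y : d x y = d y x.
Proof.
suff le u v : d u v <= d v u by apply/eqP; rewrite eqn_leq !le.
have [p [w <-]] := geodesic_exists v u.
by apply: leq_trans (gdist_le (walk_rev w)) _; rewrite size_rev size_belast.
Qed.

Lemma gdist_triangle x y z : d x z <= d x y + d y z.
Proof.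
have [p [wp <-]] := geodesic_exists x y.
have [q [wq <-]] := geodesic_exists y z.
by rewrite -size_cat; exact: gdist_le (walk_cat wp wq).
Qed.

Lemma gdist_adj x y : Gam x y -> d x y <= 1.
Proof. by move=> xy; apply: (@gdist_le _ _ [:: y]); split; rewrite //= xy. Qed.

Lemma point_at_distance x y n : n <= d x y ->
  exists w, d x w = n /\ n + d w y = d x y.
Proof.
have [p [w sp]] := geodesic_exists x y.
rewrite -sp => np; exists (last x (take n p)).
have [xp yp] := w.
have w1 : walk Gam x (last x (take n p)) (take n p).
  by split=> //; rewrite -(cat_take_drop n p) cat_path in xp; case/andP: xp.
have w2 : walk Gam (last x (take n p)) y (drop n p).
  by split; [rewrite -(cat_take_drop n p) cat_path in xp; case/andP: xp
            |rewrite -last_cat cat_take_drop].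
have := gdist_le w1; have := gdist_le w2.
have := gdist_triangle x (last x (take n p)) y.
rewrite size_take_min size_drop; lia.
Qed.

Lemma geodesic_steps x y p u v : geodesic Gam x y p -> (u, v) \in steps x p ->
  Gam u v /\ d x u + (d v y).+1 = d x y.
Proof.
move=> [[xp yp] sp] /mem_stepsP[p1 [p2 [pE uE]]].
move: xp yp sp; rewrite {}pE cat_path last_cat size_cat /= uE.
move=> /and3P[xp1 uv vp2] yp sp; split=> //.
have := @gdist_le _ _ p1 (conj xp1 uE); have := @gdist_le _ _ p2 (conj vp2 yp).
have := gdist_triangle x u y; have := gdist_triangle u v y.
have := gdist_adj uv; lia.
Qed.

Lemma geodesic_uniq x y p : geodesic Gam x y p -> uniq (x :: p).
Proof.
move=> [[xp yp] sp]; move: yp sp; case/shortenP: xp => p' xp' up' sub <- sp.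
apply: leq_size_uniq up' _ _; last by rewrite /= ltnS sp; exact: gdist_le.
by move=> z; rewrite !inE => /orP[->//|/sub ->]; rewrite orbT.
Qed.

End Walks.

(** * Edges on geodesics, and triangles in hyperbolic fine graphs *)

Section Separation.
Context {V : choiceType} {Gam : simple_graph V}.
Local Open Scope nat_scope.
Implicit Types (x y z u v w : V) (e : set V).
Local Notation d := (gdist Gam).

(** Some geodesic from [x] to [y] passes through [e]; see [unseparatedP]. This
    metric form makes most arguments about geodesics a matter of the triangle
    inequality. *)
Definition cuts e x y : Prop :=
  exists u v, [/\ Gam u v, e = [set u; v] & d x u + (d v y).+1 = d x y].

Hypothesis Gam_conn : connected_graph Gam.
Let dC := gdistC Gam_conn.
Let dT := gdist_triangle Gam_conn.

Lemma cuts_sym e x y : cuts e x y -> cuts e y x.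
Proof.
move=> [u [v [uv -> h]]]; exists v, u; split; last 1 first.
- by rewrite (dC y v) (dC u x) (dC y x); lia.
- by rewrite (adj_sym Gam).
- by rewrite setUC.
Qed.

Lemma cuts_edge e x y : cuts e x y -> edges Gam e.
Proof. by move=> [u [v [uv -> _]]]; exists (u, v). Qed.

Lemma geodesic_cat x w y p q : geodesic Gam x w p -> geodesic Gam w y q ->
  d x w + d w y = d x y -> geodesic Gam x y (p ++ q).
Proof.
move=> [wp sp] [wq sq] h; split; first exact: walk_cat wp wq.
by rewrite size_cat sp sq.
Qed.

Lemma unseparatedP e x y : unseparated Gam e (x, y) <-> ~ cuts e x y.
Proof.
split=> [sep [u [v [uv eE h]]]|ncut p gp [[u v] /= uvp eE]]; last first.
  by apply: ncut; exists u, v; have [] := geodesic_steps Gam_conn gp uvp.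
have [p gp] := geodesic_exists Gam_conn x u.
have [q gq] := geodesic_exists Gam_conn v y.
have [[[xp pu] sp] [wq sq]] := (gp, gq).
apply: (sep (p ++ v :: q)).
  split=> /=; last by rewrite size_cat /= sp sq.
  by split; rewrite ?cat_path ?last_cat /= ?pu ?uv ?xp /=; case: wq.
exists (u, v); last by [].
by rewrite steps_cat mem_cat pu steps_cons inE eqxx orbT.
Qed.

Lemma cuts_irr e x : ~ cuts e x x.
Proof.
move=> [u [v [_ _]]]; rewrite (gdistxx x); lia.
Qed.

(** The vertices that [e] does not cut from a fixed end of [e] form a
    [u_e]-small set: on a geodesic from [x] to [y] through [e], the end [c] comes
    first or second, so that [e] lies between [c] and one of [x], [y]. *)
Lemma uncut_sameside e x y c :
  e c -> ~ cuts e x c -> ~ cuts e y c -> ~ cuts e x y.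
Proof.
move=> ec xc yc [u [v [uv eE h]]]; move: ec; rewrite eE => -[cE|cE].
- apply: yc; exists v, u; split; [by rewrite (adj_sym Gam)|by rewrite setUC|].
  rewrite cE (gdistxx u); have := dT x u y; have := dT u v y.
  by have := gdist_adj uv; rewrite (dC y v) (dC y u); lia.
- apply: xc; exists u, v; split=> //.
  rewrite cE (gdistxx v); have := dT x u v; have := dT x v y.
  have := gdist_adj uv; lia.
Qed.

(** An edge does not cut [x] from the end of it that is nearest to [x]: a
    geodesic that passes through the edge and ends at [w] meets an end of the
    edge closer to [x] than [w]. *)
Lemma uncut_end x u v :
  Gam u v -> ~ cuts [set u; v] x u \/ ~ cuts [set u; v] x v.
Proof.
move=> uv; suff H w : cuts [set u; v] x w -> [set u; v] w ->
  d x u < d x w \/ d x v < d x w.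
  apply: contrapT => /not_orP[/contrapT cu /contrapT cv].
  have := H _ cu (or_introl erefl); have := H _ cv (or_intror erefl); lia.
move=> [s [t [st eE h]]] _.
by have : [set u; v] s by [rewrite eE; left]; move=> [<-|<-]; [left|right]; lia.
Qed.

Lemma cuts_exists x y : x <> y -> exists e, cuts e x y.
Proof.
move=> xy; have [p gp] := geodesic_exists Gam_conn x y.
case: p gp => [[[_ /= ] //]|u p gp].
have [xu h] := geodesic_steps (u := x) (v := u) Gam_conn gp (mem_head _ _).
by exists [set x; u], x, u.
Qed.

Lemma geodesic_mem x y p w : geodesic Gam x y p -> w \in x :: p ->
  d x w + d w y = d x y.
Proof.
move=> [[xp yp] sp] wp; move: xp yp sp; case/splitPl: wp => p1 p2 wE.
rewrite cat_path last_cat size_cat wE => /andP[xp1 wp2] yp2 sp.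
have := @gdist_le _ _ _ _ p1 (conj xp1 wE).
have := @gdist_le _ _ _ _ p2 (conj wp2 yp2).
have := dT x w y; lia.
Qed.

Lemma geodesic_path (E : rel V) x y :
  (forall u v, Gam u v -> d x u + (d v y).+1 = d x y -> E u v) ->
  exists p, [/\ path E x p, last x p = y & size p = d x y].
Proof.
move=> h; have [p gp] := geodesic_exists Gam_conn x y; exists p.
have [[xp yp] sp] := gp; split=> //; rewrite path_steps.
apply/allP => -[u v] /(geodesic_steps Gam_conn gp)[]; exact: h.
Qed.

Section Hyperbolic.
Variable delta : nat.
Hypothesis Gam_hyp : hyperbolic Gam delta.

Definition between x w y : Prop := d x w + d w y = d x y.

Lemma slim x y z w : between x w y -> exists w',
  d w w' <= delta /\ (between x w' z \/ between y w' z).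
Proof.
rewrite /between => h.
have [r1 g1] := geodesic_exists Gam_conn x w.
have [r2 g2] := geodesic_exists Gam_conn w y.
have [p gp] := geodesic_exists Gam_conn x z.
have [q gq] := geodesic_exists Gam_conn z y.
have [|w' w'pq ww'] := Gam_hyp gp gq (geodesic_cat g1 g2 h) (w := w).
  by have [[_ <-] _] := g1; rewrite -cat_cons mem_cat mem_last.
move: w'pq; rewrite mem_cat => /orP[/(geodesic_mem gp)|/(geodesic_mem gq)] hw';
  exists w'; split=> //; [by left|right].
by rewrite (dC y w') (dC w' z) (dC y z) addnC.
Qed.

(** A point [p] of the side close to [a], and a point [q] of the other two sides
    close to [p]. The bound on [d p q] makes the ball of this radius about [p],
    together with the piece of the side from [p] to [a], stay on the side of [a]
    of the edge that is considered in [detour]. Both points are [x] if [x] is too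
    close to [a]. *)
Lemma foot x y z a : between x a y -> exists p q,
  [/\ between x p a, d p a <= delta, d p q <= d p a
    & between x q z \/ between y q z].
Proof.
rewrite /between => h; have [le|lt] := leqP (d x a) delta.
  exists x, x; rewrite (gdistxx x); split=> //.
  by left.
have [|p [ap pE]] := @point_at_distance _ _ Gam_conn a x delta.
  by rewrite dC ltnW.
rewrite dC in ap; rewrite (dC p) (dC a) in pE.
have [|q [pq qE]] := @slim x y z p.
  by rewrite /between; have := dT p a y; have := dT x p y; lia.
by exists p, q; split=> //; lia.
Qed.

(** Two geodesics that end at [z] and start near each other can be joined by a
    short path at the distance [T] from the start, unless they already met at [z].
    As [T] can be chosen large, this path avoids what happens near the start. *)
Lemma bridge q1 q2 z M T : d q1 q2 <= M -> M + delta < T -> exists w1 w2,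
  [/\ between q1 w1 z, between q2 w2 z, d q1 w1 <= T, d q2 w2 <= M + T + delta
    & w1 = w2 \/ d w1 w2 <= delta /\ d q1 w1 = T].
Proof.
rewrite /between => qM MT; have [le|lt] := leqP (d q1 z) T.
  exists z, z; rewrite (gdistxx z) !addn0; split=> //; last by left.
  by have := dT q2 q1 z; rewrite (dC q2 q1); lia.
have [w1 [q1w w1z]] := point_at_distance Gam_conn (ltnW lt).
have [|w2 [w12 hw2]] := @slim q1 z q2 w1; first by rewrite /between; lia.
rewrite /between in hw2.
exists w1, w2; case: hw2 => hw2.
  by have := dT q1 w2 w1; rewrite (dC w2 w1); lia.
rewrite (dC z w2) (dC w2 q2) (dC z q2) in hw2; split; [lia|lia|lia| |by right].
have := dT q2 q1 w2; have := dT q1 w1 w2; rewrite (dC q2 q1); lia.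
Qed.

(** A bound for the seven pieces of the walk in [detour] together. *)
Definition detour_length := 20 * delta + 20.

(** An edge [a b] of a geodesic [x, y] belongs to a short circuit that uses an
    edge of a geodesic of [x, z] or [y, z]. From [a] one goes back along [x, y] to
    [p1], then to a point [q1] on the other two sides, along its side toward
    [z] to [w1], across to [w2], and back on the other side to [q2], [p2] and
    [b]. The set [A] of the vertices near the first two pieces is disjoint from
    the set [B] around the last two and from the set [X] around the crossing, so a
    simple path from [a] to [b] extracted from this walk cannot avoid the edges of
    the pieces from [q1] to [w1] and from [w2] to [q2], which lie on geodesics of
    the other two sides. *)
Lemma detour a b x y z : Gam a b -> d x a + (d b y).+1 = d x y ->
  exists p, [/\ walk Gam a b p, uniq (a :: p), size p <= detour_length
    & exists u v, (u, v) \in steps a p /\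
      (cuts [set u; v] x z \/ cuts [set u; v] y z)].
Proof.
move=> ab xaby.
have ab1 := gdist_adj ab.
have xay : between x a y.
  by rewrite /between; have := dT x a y; have := dT a b y; lia.
have ybx : between y b x.
  rewrite /between (dC y b) (dC b x) (dC y x).
  by have := dT x b y; have := dT x a b; lia.
have abE : d a b = 1 by have := dT x b y; have := dT x a b;
  have := dT x a y; have := dT a b y; lia.
have [p1 [q1 [xp1 p1a p1q1 q1s]]] := foot z xay.
have [p2 [q2 [yp2 p2b p2q2 q2s']]] := foot z ybx.
have q2s : between x q2 z \/ between y q2 z by case: q2s'; [right|left].
rewrite /between in xay ybx xp1 yp2.
have p1p2 : d p1 p2 = d p1 a + 1 + d p2 b.
  have := dT x p1 y; have := dT p1 p2 y; have := dT p1 a p2.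
  have := dT a b p2; rewrite (dC p2 b) (dC y p2) in yp2 *.
  rewrite (dC p2 y) (dC y b) in yp2; rewrite (dC p2 y); lia.
have p1b : d p1 b = d p1 a + 1.
  have := dT p1 b p2; have := dT p1 a b; rewrite (dC b p2); lia.
have p2a : d p2 a = d p2 b + 1.
  have := dT p1 a p2; have := dT p2 b a; rewrite (dC a p2) (dC b a); lia.
have q12 : d q1 q2 <= 4 * delta + 1.
  have := dT q1 p1 q2; have := dT p1 p2 q2; rewrite (dC q1 p1); lia.
(* [5 * delta + 2] is large enough for [bridge], and exceeds the distance
   [3 * delta] within which [A] and [X] could meet. *)
have [|w1 [w2 [q1w q2w q1w1 q2w2 w12]]] :=
  @bridge q1 q2 z (4 * delta + 1) (5 * delta + 2) q12; first lia.
pose Q u v := cuts [set u; v] x z \/ cuts [set u; v] y z.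
pose A u := d p1 u <= d p1 q1 \/ between p1 u a.
pose B u := d p2 u <= d p2 q2 \/ between p2 u b.
pose X u := [/\ w1 <> w2, d w1 u <= delta & d q1 w1 = 5 * delta + 2].
pose E u v := `[< Gam u v /\ [\/ Q u v, A u /\ A v, B u /\ B v | X u /\ X v] >].
have AB u : A u -> B u -> False.
  rewrite /A /B /between => hA hB; have := dT p1 u p2; have := dT p1 u b.
  have := dT p2 u a; have := dT a u b.
  by rewrite (dC u p2) (dC a u); case: hA; case: hB; lia.
have AX u : A u -> X u -> False.
  rewrite /A /X /between => hA [_ w1u q1w1E].
  have := dT p1 q1 w1; have := dT q1 p1 u; have := dT q1 u w1.
  by rewrite (dC q1 p1) (dC u w1); case: hA; lia.
have segA : exists p, [/\ path E a p, last a p = p1 & size p = d a p1].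
  apply: geodesic_path => u v uv uvE; apply/asboolP; split=> //; apply: Or42.
  rewrite /A /between; have := dT p1 u a; have := dT p1 v a.
  have := dT a u p1; have := dT a v p1; have := gdist_adj uv.
  have := dT u v p1; have := dT a u v.
  by rewrite (dC a u) (dC a v) (dC u p1) (dC v p1) (dC a p1) in uvE *; lia.
have segA' : exists p, [/\ path E p1 p, last p1 p = q1 & size p = d p1 q1].
  apply: geodesic_path => u v uv uvE; apply/asboolP; split=> //; apply: Or42.
  rewrite /A; have := dT p1 u v; have := gdist_adj uv; lia.
have segB : exists p, [/\ path E p2 p, last p2 p = b & size p = d p2 b].
  apply: geodesic_path => u v uv uvE; apply/asboolP; split=> //; apply: Or43.
  rewrite /B /between; have := dT p2 u b; have := dT p2 v b.
  have := gdist_adj uv.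
  have := dT u v b; have := dT p2 u v; lia.
have segB' : exists p, [/\ path E q2 p, last q2 p = p2 & size p = d q2 p2].
  apply: geodesic_path => u v uv uvE; apply/asboolP; split=> //; apply: Or43.
  rewrite /B; have := dT u v p2; have := gdist_adj uv.
  by rewrite (dC p2 u) (dC p2 v) (dC p2 q2); lia.
have between_cuts q w u v t : between t q z -> between q w z ->
    Gam u v -> d q u + (d v w).+1 = d q w -> cuts [set u; v] t z.
  rewrite /between => tq qw uv uvE; exists u, v; split=> //.
  have := dT t q u; have := dT v w z; have := dT t u z; have := dT u v z.
  by have := gdist_adj uv; lia.
have segQ : exists p, [/\ path E q1 p, last q1 p = w1 & size p = d q1 w1].
  apply: geodesic_path => u v uv uvE; apply/asboolP; split=> //; apply: Or41.
  by case: q1s => q1s; [left|right]; exact: between_cuts q1s q1w uv uvE.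
have segQ' : exists p, [/\ path E w2 p, last w2 p = q2 & size p = d w2 q2].
  apply: geodesic_path => u v uv uvE; apply/asboolP; split=> //; apply: Or41.
  have vu : Gam v u by rewrite (adj_sym Gam).
  have vuE : d q2 v + (d u w2).+1 = d q2 w2.
    by rewrite (dC q2 v) (dC u w2) (dC q2 w2); lia.
  rewrite /Q setUC.
  by case: q2s => q2s; [left|right]; exact: between_cuts q2s q2w vu vuE.
have segX : exists p, [/\ path E w1 p, last w1 p = w2 & size p <= delta].
  case: w12 => [<-|[w12 q1w1E]]; first by exists [::].
  have [w12E|w12E] := eqVneq w1 w2; first by rewrite -w12E; exists [::].
  suff [p [? ? sp]] :
      exists p, [/\ path E w1 p, last w1 p = w2 & size p = d w1 w2].
    by exists p; split=> //; rewrite sp.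
  apply: geodesic_path => u v uv uvE; apply/asboolP; split=> //; apply: Or44.
  have := dT w1 u v; have := gdist_adj uv.
  by split; split=> //; try exact/eqP; lia.
have [s1 [s1p s1e s1s]] := segA; have [s2 [s2p s2e s2s]] := segA'.
have [s3 [s3p s3e s3s]] := segQ; have [s4 [s4p s4e s4s]] := segX.
have [s5 [s5p s5e s5s]] := segQ'; have [s6 [s6p s6e s6s]] := segB'.
have [s7 [s7p s7e s7s]] := segB.
pose s := s1 ++ s2 ++ s3 ++ s4 ++ s5 ++ s6 ++ s7.
have sp : path E a s.
  rewrite /s !(cat_path, s1e, s2e, s3e, s4e, s5e, s6e).
  by rewrite s1p s2p s3p s4p s5p s6p.
have se : last a s = b by rewrite /s !(last_cat, s1e, s2e, s3e, s4e, s5e, s6e).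
have ss : size s <= detour_length.
  rewrite /s !size_cat s1s s2s s3s s5s s6s s7s /detour_length.
  by rewrite (dC a p1) (dC w2 q2) (dC q2 p2); lia.
move: se; case/shortenP: sp => p pE up /(uniq_leq_size (proj2 (andP up))) sps pe.
exists p; split=> //.
- by split=> //; apply: sub_path pE => u v /asboolP[].
- exact: leq_trans sps ss.
apply: contrapT => noQ; suff : A (last a p).
  rewrite pe => /AB; apply; right; rewrite /between (gdistxx b); lia.
have : A a by right; rewrite /between (gdistxx a); lia.
have : forall u v, (u, v) \in steps a p -> A u -> A v.
  move=> u v uvp Au.
  have /allP/(_ _ uvp)/= : all (fun ab => E ab.1 ab.2) (steps a p).
    by rewrite -path_steps.
  move=> /asboolP[_ [uvQ|[]|[Bu]|[Xu]]] //.
  - by case: noQ; exists u, v.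
  - by case: (AB u).
  - by case: (AX u).
elim: p (a) {up pE pe sps noQ} => [//|v p IH] u h Au.
apply: IH => [u' v' uv'|]; first by apply: h; rewrite steps_cons inE uv' orbT.
by apply: (h u v) => //; rewrite steps_cons mem_head.
Qed.

End Hyperbolic.

(** This is the triangle axiom of the Bowditch uniformity. By fineness only
    finitely many edges lie on the arcs that [detour] provides, and they do not
    depend on the triangle. *)
Lemma cuts_triangle e : (exists delta, hyperbolic Gam delta) -> Defs.fine Gam ->
  edges Gam e -> exists F : set (set V), [/\ finite_set F, F `<=` edges Gam
    & forall x y z, cuts e x y ->
        exists2 e', F e' & cuts e' x z \/ cuts e' z y].
Proof.
move=> [delta hyp] fin [[a b] /= ab eE].
pose arcs (a b : V) := [set p | [/\ walk Gam a b p, uniq (a :: p)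
  & size p <= detour_length delta]].
pose F a b := \bigcup_(p in arcs a b)
  [set [set uv.1; uv.2] | uv in [set uv | uv \in steps a p]].
have Ffin u v : finite_set (F u v).
  apply: bigcup_finite => [|p _]; first exact: fin.
  by apply: finite_image; exact: finite_seq.
have Fedge u v : F u v `<=` edges Gam.
  move=> _ [p [[up _] _ _] [[u' v'] /= uvp <-]]; exists (u', v') => //=.
  by move: up; rewrite path_steps => /allP/(_ _ uvp).
exists (F a b `|` F b a); split.
- by rewrite finite_setU.
- by move=> e' [] /Fedge.
move=> x y z [u [v [uv]]]; rewrite -eE => abE uvE.
have [p [wp up sp [u' [v' [uvp cut]]]]] := detour hyp z uv uvE.
exists [set u'; v']; last by case: cut => [?|/cuts_sym]; [left|right].
have Fp : F u v [set u'; v'] by exists p => //; exists (u', v').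
suff [<-|<-] : F u v = F a b \/ F u v = F b a by [left|right].
have ua : [set a; b] u by rewrite abE; left.
have va : [set a; b] v by rewrite abE; right.
have uNv : u <> v by move=> uE; rewrite uE (adj_irr Gam) in uv.
by move: ua va uNv => [->|->] [->|->]; [|left|right|].
Qed.

End Separation.

Arguments cuts {V} Gam e x y.

(** * Relatively hyperbolic actions on graphs *)

Section Action.
Context {G : groupType} {V : choiceType} {Gam : simple_graph V}.
Variable a : graph_action G Gam.
Hypothesis a_rh : relatively_hyperbolic_action a.
Implicit Types (x y z u v w : V) (e : set V) (g : G).
Local Notation d := (gdist Gam).
Local Notation cuts := (cuts Gam).

Lemma rh_connected : connected_graph Gam.
Proof. by have [[]] := a_rh. Qed.
Let conn := rh_connected.

Lemma rh_cuts_triangle e : edges Gam e ->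
  exists F : set (set V), [/\ finite_set F, F `<=` edges Gam
    & forall x y z, cuts e x y -> exists2 f, F f & cuts f x z \/ cuts f z y].
Proof. by have [[_ hyp fin] _] := a_rh; exact: cuts_triangle. Qed.

Lemma rh_nontrivial : exists v w, v <> w.
Proof.
have [_ [_ _ nofix]] := a_rh; have [[v _] _] := conn.
by have [g gv] := nofix v; exists (a g v), v.
Qed.

Lemma image_actM g h e : a g @` (a h @` e) = a (g * h)%g @` e.
Proof.
apply/seteqP; split=> [_ [_ [x ex <-] <-]|_ [x ex <-]].
  by exists x; rewrite ?actM.
by exists (a h x); [exists x|rewrite actM].
Qed.

Lemma image_act1 e : a 1%g @` e = e.
Proof.
apply/seteqP; split=> [_ [x ex <-]|x ex]; first by rewrite act1.
by exists x; rewrite ?act1.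
Qed.

Lemma cuts_act g e x y : cuts e x y -> cuts (a g @` e) (a g x) (a g y).
Proof.
move=> [u [v [uv -> h]]]; exists (a g u), (a g v); split.
- by rewrite gact_adj.
- by rewrite image_setU !image_set1.
- by rewrite !gdist_act.
Qed.

Lemma cuts_actV g e x y : cuts e (a g x) (a g y) -> cuts (a g^-1%g @` e) x y.
Proof. by move=> /(cuts_act g^-1%g); rewrite !actK. Qed.

(** Geodesics are arcs of a fixed length, so this is an instance of fineness. *)
Lemma finite_cuts x y : finite_set [set e | cuts e x y].
Proof.
have [[_ _ fin] _] := a_rh.
apply: (@sub_finite_set _ _ (\bigcup_(p in
   [set p | [/\ walk Gam x y p, uniq (x :: p) & (size p <= d x y)%N]])
  [set [set uv.1; uv.2] | uv in [set uv | uv \in steps x p]])); last first.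
  apply: bigcup_finite => [|p _]; first exact: fin.
  by apply: finite_image; exact: finite_seq.
move=> e /= ce; apply: contrapT => ncov.
suff /(unseparatedP conn) : unseparated Gam e (x, y) by [].
move=> p gp [uv /= uvp eE]; apply: ncov; exists p; last by exists uv.
by split; [case: gp|exact: geodesic_uniq gp|case: gp => _ ->].
Qed.

Lemma finite_transporter e f : edges Gam e -> finite_set [set g | a g @` e = f].
Proof.
move=> eE; have [[g0 g0e]|no] := pselect (exists g, a g @` e = f); last first.
  by apply: (@sub_finite_set _ _ set0) => // g /= ge; apply: no; exists g.
have [_ [fin _ _]] := a_rh.
apply: (@sub_finite_set _ _ [set (g0 * h)%g | h in [set h | a h @` e = e]]).
  move=> g /= ge; exists (g0^-1 * g)%g; last by rewrite mulgA mulgV mul1g.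
  by rewrite /= -image_actM ge -g0e image_actM mulVg image_act1.
by apply: finite_image; exact: fin.
Qed.

Lemma finite_cuts_act e x y : finite_set [set g | cuts e (a g x) (a g y)].
Proof.
apply: (@sub_finite_set _ _ (\bigcup_(f in [set f | cuts f x y])
    [set g | a g @` f = e])).
  move=> g /= /cuts_actV ce; exists (a g^-1%g @` e) => //=.
  by rewrite image_actM mulgV image_act1.
apply: bigcup_finite => [|f /cuts_edge]; first exact: finite_cuts.
exact: finite_transporter.
Qed.

Lemma finite_edge e : edges Gam e -> finite_set e.
Proof.
by move=> [[u v] _ <-] /=; rewrite finite_setU; split; exact: finite_set1.
Qed.

(** This carries the convergence dynamics. Let [F] and [F'] be the finite sets of
    [cuts_triangle] for [e] and [f]. For all but finitely many [g], no edge of [F]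
    cuts [g^-1 p] from [g^-1 v] for an end [p] of an edge of [F'], and symmetrically.
    Then for each such [p] some edge of [F] lies on a geodesic from [x] to [g^-1 p],
    and has an end [q] closer to [x]; likewise for each such [q] some [g^-1 p] is
    closer to [x] than [q]. This is an infinite descent. *)
Lemma finite_linked e f v : edges Gam e -> edges Gam f ->
  finite_set [set g | exists x,
    cuts e x (a g^-1%g v) /\ cuts f (a g x) (a g v)].
Proof.
move=> /rh_cuts_triangle[F [Ffin Fe eF]] /rh_cuts_triangle[F' [F'fin F'e fF']].
pose Q := \bigcup_(e' in F) e'; pose P := \bigcup_(f' in F') f'.
have Qfin : finite_set Q.
  by apply: bigcup_finite => // e' /Fe; exact: finite_edge.
have Pfin : finite_set P.
  by apply: bigcup_finite => // f' /F'e; exact: finite_edge.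
pose B1 := \bigcup_(e' in F) \bigcup_(p in P)
  [set h^-1%g | h in [set h | cuts e' (a h p) (a h v)]].
pose B2 := \bigcup_(f' in F') \bigcup_(q in Q)
  [set g | cuts f' (a g q) (a g v)].
apply: (@sub_finite_set _ _ (B1 `|` B2)); last first.
  rewrite finite_setU; split; apply: bigcup_finite => // e' _;
    apply: bigcup_finite => // p _; last exact: finite_cuts_act.
  by apply: finite_image; exact: finite_cuts_act.
move=> g [x [ce cf]]; apply: contrapT => /not_orP[nB1 nB2].
have toQ p : P p -> exists2 q, Q q & (d x q < d x (a g^-1%g p))%N.
  move=> Pp; have [e' Fe' [c|c]] := eF _ _ (a g^-1%g p) ce; last first.
    by case: nB1; exists e' => //; exists p => //; exists g^-1%g; rewrite ?invgK.
  have [u [w [uw e'E h]]] := c; exists u; last by lia.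
  by exists e' => //; rewrite e'E; left.
have toP q : Q q -> exists2 p, P p & (d x (a g^-1%g p) < d x q)%N.
  move=> Qq; have [f' Ff' [c|c]] := fF' _ _ (a g q) cf; last first.
    by case: nB2; exists f' => //; exists q.
  have [u [w [uw f'E h]]] := c; exists u.
    by exists f' => //; rewrite f'E; left.
  by rewrite -(gdist_act a g) actKV -(gdist_act a g x q); lia.
have noQ n q : Q q -> (d x q <= n)%N -> False.
  elim: n q => [|n IH] q Qq le; have [p Pp lt] := toP q Qq; first by lia.
  by have [q' Qq' lt'] := toQ p Pp; apply: (IH q' Qq'); lia.
have [e' Fe' [[u [w [uw e'E h]]]|/cuts_irr[]//]] := eF _ _ (a g^-1%g v) ce.
by apply: (noQ (d x u) u) => //; exists e' => //; rewrite e'E; left.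
Qed.

End Action.

(** * Completions of uniformities *)

Lemma fmap_ultra (S T : Type) (f : S -> T) (F : set_system S) :
  UltraFilter F -> UltraFilter (fmap f F).
Proof.
move=> FU; split; first exact: fmap_proper_filter.
move=> H HF sub; apply/seteqP; split=> // A HA.
have [//|nA] := in_ultra_setVsetC (f @^-1` A) FU.
have /filter_ex[x []//] : H (A `&` ~` A) by apply: filterI HA _; exact: sub.
Qed.

Record is_uniformity (T : Type) (U : set_system (T * T)) : Prop := {
  is_uniformity_diag : forall E, U E -> forall x, E (x, x);
  is_uniformity_sym : forall E, U E -> U [set xy | E (xy.2, xy.1)];
  is_uniformity_split : forall E, U E ->
    exists2 D, U D & forall x y z, D (x, y) -> D (y, z) -> E (x, z) }.

Section CompletionTheory.
Context {T : Type}.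
Variable U : filter_on (T * T).
Local Notation ent := (U : set_system (T * T)).
Implicit Types (xi eta zeta : completion U) (F : set_system T).
Implicit Types (E D : set (T * T)).
Local Notation close := (@completion_close _ U).

Lemma pfilt_proper xi : ProperFilter (pfilt xi).
Proof. by have [[]] := pfiltP xi. Qed.
#[local] Existing Instance pfilt_proper.

Lemma pfilt_cauchy xi E : ent E -> exists2 A, pfilt xi A & A `*` A `<=` E.
Proof. by have [[_ h] _] := pfiltP xi => /h. Qed.

Lemma completion_eq xi eta : pfilt xi = pfilt eta -> xi = eta.
Proof.
case: xi eta => [F hF] [F' hF'] /= FF'; rewrite -FF' in hF' *.
by congr CompletionPoint; exact: Prop_irrelevance.
Qed.

Definition entourage_ball E (B : set T) : set T :=
  [set y | exists2 x, B x & E (x, y)].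

Hypothesis unifU : is_uniformity ent.
Let diagU := is_uniformity_diag unifU.
Let symU := is_uniformity_sym unifU.
Let splitU := is_uniformity_split unifU.

Lemma split3U E : ent E -> exists D, [/\ ent D, D `<=` E,
  (forall x y, D (x, y) -> D (y, x)) &
  forall w x y z, D (w, x) -> D (x, y) -> D (y, z) -> E (w, z)].
Proof.
move=> /splitU[D1 UD1 DE] ; have /splitU[D2 UD2 DD1] := UD1.
exists (D2 `&` [set xy | D2 (xy.2, xy.1)]); split.
- exact: filterI UD2 (symU UD2).
- move=> [x y] [/= D2xy _]; apply: (DE _ y); last exact: diagU.
  by apply: DD1 D2xy _; exact: diagU.
- by move=> x y [/= ? ?]; split.
- move=> w x y z [/= wx _] [/= xy _] [/= yz _].
  by apply: (DE _ y); [exact: DD1 wx xy|apply: DD1 yz _; exact: diagU].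
Qed.

(** The point is the filter generated by the uniform neighbourhoods of the
    members of [F]: every Cauchy filter coarser than [F] contains them. *)
Lemma cauchy_limit F : cauchy_filter ent F ->
  exists xi : completion U, pfilt xi `<=` F.
Proof.
move=> [FF FU].
pose M := [set A | exists E, exists2 B, ent E /\ F B &
  entourage_ball E B `<=` A].
have MF : M `<=` F.
  move=> A [E [B [UE FB]] sub]; apply: filterS FB => x Bx; apply: sub.
  by exists x => //; exact: diagU.
have Mfilter : ProperFilter M.
  apply: Build_ProperFilter_ex; first by move=> A /MF/filter_ex.
  split.
  - by exists setT, setT => //; split; exact: filterT.
  - move=> A A' [E [B [UE FB] sub]] [E' [B' [UE' FB'] sub']].
    exists (E `&` E'), (B `&` B'); first by split; exact: filterI.
    by move=> y [x [Bx B'x] [Exy E'xy]]; split; [apply: sub|apply: sub']; exists x.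
  - move=> A A' AA' [E [B h sub]]; exists E, B => //; exact: subset_trans AA'.
have Mcauchy : cauchy_filter ent M.
  split=> // E /split3U[D [UD _ Dsym DE]]; have [B FB BD] := FU _ UD.
  exists (entourage_ball D B); first by exists D, B.
  move=> [y y'] [/= [x Bx xy] [x' Bx' xy']].
  by apply: (DE y x x' y') => //; [exact: Dsym|exact: (BD (x, x'))].
have Mmin : minimal_cauchy ent M.
  split=> // F' [FF' F'U] F'M; apply/seteqP; split=> // A [E [B [UE FB] sub]].
  have [C F'C CE] := F'U _ UE.
  have /filter_ex[x [Bx Cx]] : F (B `&` C) by apply: filterI => //; apply/MF/F'M.
  apply: filterS F'C => y Cy; apply: sub; exists x => //; exact: (CE (x, y)).
by exists (CompletionPoint Mmin).
Qed.

(** A small member of [xi] meets [B], since both belong to [F]. *)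
Lemma limit_ball F xi E B : ProperFilter F -> pfilt xi `<=` F -> ent E -> F B ->
  pfilt xi (entourage_ball E B).
Proof.
move=> FF xiF UE FB; have [C xiC CE] := pfilt_cauchy xi UE.
have /filter_ex[x [Bx Cx]] : F (B `&` C) by apply: filterI => //; exact: xiF.
by apply: filterS xiC => y Cy; exists x => //; exact: (CE (x, y)).
Qed.

Lemma close_refl E xi : ent E -> close E xi xi.
Proof. by move=> /(pfilt_cauchy xi)[A xA AE]; exists A. Qed.

Lemma close_sym E xi eta : close E xi eta -> close E eta xi.
Proof. by move=> [A [? ? ?]]; exists A. Qed.

(** Small sets with a common point have a small union; this is how two filters are
    shown to be close. *)
Lemma small_setU E D A B x : (forall x, D (x, x)) ->
  (forall x y z, D (x, y) -> D (y, z) -> E (x, z)) ->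
  A `*` A `<=` D -> B `*` B `<=` D -> A x -> B x ->
  (A `|` B) `*` (A `|` B) `<=` E.
Proof.
move=> Dd DE AD BD Ax Bx [y z] [/= [Ay|By] [Az|Bz]]; apply: (DE y x z);
  by [apply: (AD (_, _))|apply: (BD (_, _))].
Qed.

Lemma close_trans E D xi eta zeta : ent D ->
  (forall x y z, D (x, y) -> D (y, z) -> E (x, z)) ->
  close D xi eta -> close D eta zeta -> close E xi zeta.
Proof.
move=> UD DE [A [xiA etaA AD]] [B [etaB zetaB BD]].
have /filter_ex[x [Ax Bx]] : pfilt eta (A `&` B) by exact: filterI.
exists (A `|` B); split.
- by apply: filterS xiA => y; left.
- by apply: filterS zetaB => y; right.
- exact: small_setU (diagU UD) DE AD BD Ax Bx.
Qed.

(** The sets common to [xi] and [eta] form a Cauchy filter, so minimality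
    identifies both filters with it. *)
Lemma close_eq xi eta : (forall E, ent E -> close E xi eta) -> xi = eta.
Proof.
move=> cl; apply: completion_eq.
pose F := [set A | pfilt xi A /\ pfilt eta A].
have FC : cauchy_filter ent F.
  split; last by move=> E /cl[A [? ? ?]]; exists A.
  apply: Build_ProperFilter_ex; first by move=> A [/filter_ex].
  split; first by split; exact: filterT.
    by move=> A B [? ?] [? ?]; split; exact: filterI.
  by move=> A B AB [? ?]; split; [apply: filterS AB _|apply: filterS AB _].
have [_ /(_ F FC) minxi] := pfiltP xi; have [_ /(_ F FC) mineta] := pfiltP eta.
by transitivity F; [apply/esym/minxi => A []|apply/mineta => A []].
Qed.

Lemma limit_unique F xi eta : ProperFilter F ->
  pfilt xi `<=` F -> pfilt eta `<=` F -> xi = eta.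
Proof.
move=> FF xiF etaF; apply: close_eq => E /splitU[D UD DE].
have [A xiA AD] := pfilt_cauchy xi UD; have [B etaB BD] := pfilt_cauchy eta UD.
have /filter_ex[x [Ax Bx]] : F (A `&` B).
  by apply: filterI; [exact: xiF|exact: etaF].
exists (A `|` B); split; last exact: small_setU (diagU UD) DE AD BD Ax Bx.
- by apply: filterS xiA => y; left.
- by apply: filterS etaB => y; right.
Qed.

Lemma close_bridge E D xi eta A B x y : D `<=` E ->
  (forall x y, D (x, y) -> D (y, x)) ->
  (forall w x y z, D (w, x) -> D (x, y) -> D (y, z) -> E (w, z)) ->
  pfilt xi A -> pfilt eta B -> A `*` A `<=` D -> B `*` B `<=` D ->
  A x -> B y -> D (x, y) -> close E xi eta.
Proof.
move=> sub Dsym DE xiA etaB AD BD Ax By xy; exists (A `|` B); split.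
- by apply: filterS xiA => z; left.
- by apply: filterS etaB => z; right.
move=> [z t] [/= [Az|Bz] [At|Bt]].
- exact/sub/AD.
- by apply: DE xy _; [exact: (AD (_, _))|exact: (BD (_, _))].
- by apply: DE (Dsym _ _ xy) _; [exact: (BD (_, _))|exact: (AD (_, _))].
- exact/sub/BD.
Qed.

Lemma completion_nbhs xi (N : set (completion U)) :
  nbhs xi N <-> exists2 E, ent E & [set eta | close E xi eta] `<=` N.
Proof.
split=> [|[E UE EN]].
  rewrite nbhsE => -[W [oW Wxi] WN]; have [E UE EW] := oW _ Wxi.
  by exists E => //; exact: subset_trans WN.
rewrite nbhsE; pose W := [set eta | exists2 D, ent D &
  [set zeta | close D eta zeta] `<=` N].
exists W; last by move=> eta [D UD]; apply; exact: close_refl.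
split; last by exists E.
move=> eta [D UD DN]; have [D' UD' D'D] := splitU UD.
exists D' => // zeta cl; exists D' => // theta cl'; apply: DN.
exact: close_trans UD' D'D cl cl'.
Qed.

Lemma completion_hausdorff : hausdorff_space (completion U).
Proof.
move=> xi eta cl; apply: close_eq => E /splitU[D UD DE].
have [||zeta [/= c c']] :=
  cl [set zeta | close D xi zeta] [set zeta | close D eta zeta].
- by apply/completion_nbhs; exists D.
- by apply/completion_nbhs; exists D.
- exact: close_trans UD DE c (close_sym c').
Qed.

(** Given an ultrafilter [Phi] on the completion, the sets that belong to
    almost all its points form a filter on [T]. A limit [r] of an ultrafilter
    finer than this one is a limit of [Phi]: otherwise a small member of [r]
    would be disjoint from a member of almost every point. *)
Lemma completion_compact :
  (forall F, UltraFilter F -> cauchy_filter ent F) ->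
  compact [set: completion U].
Proof.
move=> ultraC; rewrite compact_ultra => Phi PhiU _.
pose Psi := [set A | Phi [set xi | pfilt xi A]].
have PsiF : ProperFilter Psi.
  apply: Build_ProperFilter_ex.
    move=> A PA; have /filter_ex[xi xiA] : Phi [set xi | pfilt xi A] by [].
    exact: filter_ex xiA.
  split; rewrite /Psi /=.
  - have sub : [set: completion U] `<=` [set xi | pfilt xi setT].
      by move=> xi _ /=; exact: filterT.
    exact: filterS sub filterT.
  - move=> A B PA PB.
    have sub : [set xi : completion U | pfilt xi A] `&` [set xi | pfilt xi B] `<=`
        [set xi | pfilt xi (A `&` B)] by move=> xi [/= ? ?]; exact: filterI.
    exact: (@filterS _ Phi _ _ _ sub (@filterI _ Phi _ _ _ PA PB)).
  - move=> A B AB PA.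
    have sub : [set xi : completion U | pfilt xi A] `<=` [set xi | pfilt xi B].
      by move=> xi /=; exact: filterS.
    exact: (@filterS _ Phi _ _ _ sub PA).
have [Psi' [/[dup] /ultraC Psi'C Psi'U sub]] := ultraFilterLemma PsiF.
have [r rPsi'] := cauchy_limit Psi'C.
exists r; split=> // N /completion_nbhs[E UE EN]; apply: filterS EN _.
have [//|far] := in_ultra_setVsetC [set eta | close E r eta] PhiU.
have [D UD DE] := splitU UE; have [A rA AD] := pfilt_cauchy r UD.
have /sub PnA : Psi (~` A).
  apply: filterS far => xi nclose; have [B xiB BD] := pfilt_cauchy xi UD.
  apply: filterS (xiB) => x Bx Ax; apply: nclose.
  exists (A `|` B); split; last exact: small_setU (diagU UD) DE AD BD Ax Bx.
    by apply: filterS rA => y; left.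
  by apply: filterS xiB => y; right.
by have /filter_ex[x []] : Psi' (A `&` ~` A) by apply: filterI => //; exact: rPsi'.
Qed.

End CompletionTheory.

(** * The Bowditch uniformity *)

Section BowditchUniformity.
Context {G : groupType} {V : choiceType} {Gam : simple_graph V}.
Variable a : graph_action G Gam.
Hypothesis a_rh : relatively_hyperbolic_action a.
Local Notation cuts := (cuts Gam).
Local Notation ent := (bowditch_entourages Gam).
Let conn := rh_connected a_rh.
Let entF : Filter ent := bowditch_entourages_filter Gam.
Let entI P Q : ent P -> ent Q -> ent (P `&` Q) := @filterI _ ent entF P Q.
Let entS P Q : P `<=` Q -> ent P -> ent Q := @filterS _ ent entF P Q.

Lemma bowditch_entourages_ind (X : set_system (V * V)) : Filter X ->
  (forall e, edges Gam e -> X (unseparated Gam e)) -> ent `<=` X.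
Proof. by move=> FX Xe; apply: smallest_sub => // _ [e ee <-]; exact: Xe. Qed.

Lemma unseparated_entourage e : edges Gam e -> ent (unseparated Gam e).
Proof. by move=> ee; apply: sub_gen_smallest; exists e. Qed.

Lemma bowditch_diag E : ent E -> forall x, E (x, x).
Proof.
apply: (@bowditch_entourages_ind [set E | forall x, E (x, x)]) => [|e _ x].
  split=> [//|P Q Px Qx x|P Q PQ Px x]; [by split|exact: PQ].
by apply/unseparatedP => //; exact: cuts_irr.
Qed.

Lemma bowditch_sym E : ent E -> ent [set xy | E (xy.2, xy.1)].
Proof.
apply: (@bowditch_entourages_ind
  [set E | ent [set xy | E (xy.2, xy.1)]]) => [|e ee].
  split=> [|P Q /= EP EQ|P Q PQ /= EP] /=.
  - exact: (@filterT _ _ _).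
  - exact: entI EP EQ.
  - by apply: entS EP => xy; exact: PQ.
apply: entS (unseparated_entourage ee) => -[x y] /= /(unseparatedP conn) nc.
by apply/(unseparatedP conn) => /(cuts_sym conn); exact: nc.
Qed.

Lemma bowditch_split E : ent E ->
  exists2 D, ent D & forall x y z, D (x, y) -> D (y, z) -> E (x, z).
Proof.
apply: (@bowditch_entourages_ind [set E | exists2 D, ent D &
    forall x y z, D (x, y) -> D (y, z) -> E (x, z)]) => [|e ee].
  split=> [|P Q [D UD DP] [D' UD' DQ]|P Q PQ [D UD DP]] /=.
  - by exists setT => //; exact: filterT.
  - exists (D `&` D'); first exact: entI.
    by move=> x y z [? ?] [? ?]; split; [apply: DP|apply: DQ]; eassumption.
  - by exists D => // x y z xy yz; apply: PQ; exact: DP xy yz.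
have [F [Ffin Fe tri]] := rh_cuts_triangle a_rh ee.
have [X FX] := (proj1 finite_fsetP) Ffin; rewrite {}FX in Fe tri.
exists (\bigcap_(f in [set` X]) unseparated Gam f).
  apply: (@filter_bigI _ _ _ _ _ entF) => f fX.
  by apply: unseparated_entourage; exact: Fe.
move=> x y z xy yz; apply/(unseparatedP conn) => /tri-/(_ y)[f fX [c|c]].
- by have /(unseparatedP conn) := xy f fX; exact.
- by have /(unseparatedP conn) := yz f fX; exact.
Qed.

Lemma bowditch_uniformity : is_uniformity ent.
Proof.
by split; [exact: bowditch_diag|exact: bowditch_sym|exact: bowditch_split].
Qed.

Lemma bowditch_separated x y : x <> y -> exists2 E, ent E & ~ E (x, y).
Proof.
move=> /(cuts_exists conn)[e c]; exists (unseparated Gam e).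
  apply: unseparated_entourage; exact: cuts_edge c.
by move=> /(unseparatedP conn).
Qed.

(** The two sets of vertices that [e] does not cut from a given end are small
    and cover all vertices, so one of them belongs to the ultrafilter. *)
Lemma bowditch_ultra_cauchy (Psi : set_system V) :
  UltraFilter Psi -> cauchy_filter ent Psi.
Proof.
move=> PsiU; split; first exact: ultra_proper.
apply: (@bowditch_entourages_ind
  [set E | exists2 A, Psi A & A `*` A `<=` E]) => [|e].
  split=> [|P Q [A PA AP] [B PB BQ]|P Q PQ [A PA AP]] /=.
  - by exists setT => //; exact: filterT.
  - exists (A `&` B); first exact: filterI.
    by move=> xy [[? ?] [? ?]]; split; [apply: AP|apply: BQ].
  - by exists A => //; exact: subset_trans PQ.
move=> [[u v] /= uv <-].
have small w : [set u; v] w -> Psi [set x | ~ cuts [set u; v] x w] ->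
    exists2 A, Psi A & A `*` A `<=` unseparated Gam [set u; v].
  move=> ew PA; exists [set x | ~ cuts [set u; v] x w] => // -[x y] [/= xw yw].
  by apply/(unseparatedP conn); exact: (uncut_sameside conn ew).
have [Pu|Pnu] := in_ultra_setVsetC [set x | ~ cuts [set u; v] x u] PsiU.
  by apply: (small u) => //; left.
apply: (small v); first by right.
apply: filterS Pnu => x /=; have [//|] := uncut_end x uv.
by move=> ? ?.
Qed.

Section Escaping.
Variable Phi : set_system G.
Hypothesis PhiF : Filter Phi.
Hypothesis Phi_free : forall A, finite_set A -> Phi (~` A).

(** Only finitely many edges lie on geodesics from [x] to [y], and edge
    stabilizers are finite. *)
Lemma escaping_orbits x y E : ent E -> Phi [set g | E (a g x, a g y)].
Proof.
move: E; apply: (@bowditch_entourages_ind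
  (fmap (fun g => (a g x, a g y)) Phi)) => e ee.
apply: (@filterS _ Phi) (Phi_free (finite_cuts_act a_rh e x y)) => g nc.
by apply/(unseparatedP conn).
Qed.

(** Membership in the intersection of two entourages can be checked separately, so
    this reduces to generators, where it is [finite_linked]. *)
Lemma escaping_dynamics v E E' : ent E -> ent E' ->
  Phi [set g | forall x, E (x, a g^-1%g v) \/ E' (a g x, a g v)].
Proof.
move=> UE; apply: (@bowditch_entourages_ind
  [set E' | Phi [set g | forall x,
     E (x, a g^-1%g v) \/ E' (a g x, a g v)]]) => [|f fe].
  split=> [|P Q /= EP EQ|P Q PQ /= EP] /=.
  - by apply: filterS filterT => g _ x; right.
  - apply: filterS (filterI EP EQ) => g [/= gP gQ] x.
    by case: (gP x) => [|Px]; [left|case: (gQ x) => [|Qx]; [left|right; split]].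
  - by apply: filterS EP => g /= gP x; case: (gP x) => [|/PQ]; [left|right].
move: E UE; apply: (@bowditch_entourages_ind [set E | Phi [set g | forall x,
  E (x, a g^-1%g v) \/ unseparated Gam f (a g x, a g v)]]) => [|e ee].
  split=> [|P Q /= EP EQ|P Q PQ /= EP] /=.
  - by apply: filterS filterT => g _ x; left.
  - apply: filterS (filterI EP EQ) => g [/= gP gQ] x.
    by case: (gP x) => [Px|]; [case: (gQ x) => [Qx|]; [left; split|right]|right].
  - by apply: filterS EP => g /= gP x; case: (gP x) => [/PQ|]; [left|right].
apply: filterS (Phi_free (finite_linked a_rh v ee fe)) => g /= nlink x.
have [c|c] := pselect (cuts e x (a g^-1%g v)); last first.
  by left; apply/(unseparatedP conn).
by right; apply/(unseparatedP conn) => c'; apply: nlink; exists x.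
Qed.

End Escaping.

End BowditchUniformity.

(** * The Floyd metric and uniform continuity of orbit maps *)

Lemma finite_bound (T : eqType) (A : set T) (P : T -> nat -> Prop) :
  finite_set A -> (forall x m n, (m <= n)%N -> P x m -> P x n) ->
  (forall x, A x -> exists n, P x n) -> exists n, forall x, A x -> P x n.
Proof.
move=> /finite_seqP[s ->] Pmon; elim: s => [_|y s IH h]; first by exists 0%N.
have [|n hn] := IH; first by move=> x xs; apply: h; rewrite /= inE xs orbT.
have [|m hm] := h y; first exact: mem_head.
exists (maxn m n) => x /=; rewrite inE => /orP[/eqP ->|xs].
  by apply: Pmon hm; exact: leq_maxl.
by apply: Pmon (hn x xs); exact: leq_maxr.
Qed.

Section WordLength.
Context {G : groupType} (S : set G).
Hypothesis Sgen : generates S.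
Local Notation wlen := (gdist (cayley_graph S) 1%g).

Lemma cayley_connected : connected_graph (cayley_graph S).
Proof.
pose linked x y := exists p, walk (cayley_graph S) x y p.
have linkT x y z : linked x y -> linked y z -> linked x z.
  by move=> [p xy] [q yz]; exists (p ++ q); exact: walk_cat xy yz.
have linkC x y : linked x y -> linked y x.
  by move=> [p xy]; exists (rev (belast x p)); exact: walk_rev.
have linkM g x y : linked x y -> linked (g * x)%g (g * y)%g.
  move=> [p /(walk_act (cayley_action S) g) w].
  by exists (map (cayley_action S g) p).
split; first by exists 1%g.
have l1 x : linked 1%g x.
  suff L1 : [set x | linked 1%g x] = setT.
    by have : [set: G] x by []; rewrite -L1.
  apply: Sgen; last first.
    move=> s Ss; have [->|s1] := eqVneq s 1%g; first by exists [::].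
    exists [:: s]; split => //=; rewrite andbT; apply/asboolP; split.
      by apply/eqP; rewrite eq_sym.
    by exists s => //; left; rewrite mul1g.
  split; first by rewrite inE; exists [::].
  move=> u v; rewrite !inE /= => lu lv; apply: linkT lu _; apply: linkC.
  by have := linkM (u * v^-1)%g _ _ lv; rewrite mulg1 -mulgA mulVg mulg1.
by move=> x y; apply: linkT (l1 y); exact: linkC.
Qed.

Lemma wlen_mul g h : (wlen (g * h)%g <= wlen g + wlen h)%N.
Proof.
rewrite -(gdist_act (cayley_action S) g 1%g h) /= mulg1.
exact: (gdist_triangle cayley_connected).
Qed.

End WordLength.

Section FloydLength.
Context {R : realType} {G : groupType} (S : set G) (lam : R).
Hypothesis lam01 : 0 < lam < 1.
Local Notation wlen := (gdist (cayley_graph S) 1%g).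
Local Notation length := (floyd_length S lam).

Let lam_gt0 : 0 < lam. Proof. by case/andP: lam01. Qed.
Let lam_le1 : lam <= 1. Proof. by case/andP: lam01 => _ /ltW. Qed.

Lemma floyd_length_ge0 x p : 0 <= length x p.
Proof. by apply: sumr_ge0 => ab _; rewrite exprn_ge0 // ltW. Qed.

Lemma floyd_length_nil x : length x [::] = 0.
Proof. by rewrite /floyd_length big_nil. Qed.

Lemma floyd_length_cons x y p :
  length x (y :: p) = lam ^+ minn (wlen x) (wlen y) + length y p.
Proof. by rewrite /floyd_length steps_cons big_cons. Qed.

Lemma floyd_length_cat x p q :
  length x (p ++ q) = length x p + length (last x p) q.
Proof. by rewrite /floyd_length steps_cat big_cat. Qed.

(** A path whose length is at most [A + B] is cut at one edge into parts of
    lengths at most [A] and [B]; the length of the edge itself is not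
    controlled. *)
Lemma floyd_length_split A B x p : 0 <= A -> 0 <= B -> p != [::] ->
  length x p <= A + B -> exists p1 y p2,
  [/\ p = p1 ++ y :: p2, length x p1 <= A & length y p2 <= B].
Proof.
move=> A0 B0; elim: p x A A0 => [//|y p IH] x A A0 _.
rewrite floyd_length_cons; set w := lam ^+ _ => le.
have [leB|ltB] := lerP (length y p) B.
  by exists [::], y, p; rewrite floyd_length_nil.
have pN0 : p != [::].
  by apply: contraTneq ltB => ->; rewrite floyd_length_nil -leNgt.
have Aw : 0 <= A - w.
  by rewrite subr_ge0 -(lerD2r B); apply: le_trans le; rewrite lerD2l ltW.
have leAw : length y p <= A - w + B.
  by rewrite addrAC lerBrDr (addrC (length _ _)).
have [p1 [z [p2 [-> le1 le2]]]] := IH y (A - w) Aw pN0 leAw.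
by exists (y :: p1), z, p2; split => //; rewrite floyd_length_cons addrC -lerBrDr.
Qed.

Lemma floyd_dist_le (c : R) x y : connected_graph (cayley_graph S) ->
  (forall p, walk (cayley_graph S) x y p -> c <= length x p) ->
  c <= floyd_dist S lam x y.
Proof.
move=> [_ /(_ x y)[p w]] h; apply: lb_le_inf; first by exists (length x p), p.
by move=> _ [q wq <-]; exact: h.
Qed.

(** The Floyd metric is bounded below near each [x]: the first edge of a path from
    [x] has length at least [lam ^+ wlen x]. So the neighbourhood filter of [x]
    contains all sets that contain [x], and a Cauchy filter that is coarser than an
    ultrafilter containing the singleton of [x] can only be this one. *)
Lemma floyd_boundary_free xi (F : set_system G) :
  connected_graph (cayley_graph S) -> floyd_boundary S lam xi ->
  UltraFilter F -> pfilt xi `<=` F -> forall A, finite_set A -> F (~` A).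
Proof.
move=> conn bd FU xiF A /finite_fsetP[X ->].
have -> : ~` [set` X] = \bigcap_(x in [set` X]) ~` [set x].
  apply/seteqP; split=> [x nx y yX xy|x h xX]; last exact: (h x xX).
  by apply: nx; rewrite xy.
apply: filter_bigI => x _; have [Fx|//] := in_ultra_setVsetC [set x] FU.
case: (bd x); have xin B : pfilt xi B -> B x.
  move=> /xiF FB.
  have /filter_ex[y [By yx]] : F (B `&` [set x]) by exact: filterI.
  by rewrite -yx.
apply/seteqP; split=> B.
  move=> /xin Bx; exists [set yz | floyd_dist S lam yz.1 yz.2 < lam ^+ wlen x].
    by exists (lam ^+ wlen x) => //=; rewrite exprn_gt0.
  move=> y /=; have [<- //|/eqP xy] := pselect (x = y).
  rewrite ltNge => /negP[]; apply: floyd_dist_le => // -[[_ /= yx]|z p _].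
    by rewrite yx eqxx in xy.
  rewrite floyd_length_cons ler_wpDr ?floyd_length_ge0 //.
  by apply: ler_wiXn2l; [exact: ltW|exact: lam_le1|exact: geq_minl].
move=> [E UE EB]; have [C xiC CE] := pfilt_cauchy xi UE; have xiF' := pfilt_proper xi.
apply: filterS (xiC) => y Cy; apply: EB; apply: (CE (x, y)); split=> //.
exact: xin xiC.
Qed.

End FloydLength.

Lemma bernoulli_ineq (R : realType) (x : R) n :
  0 <= x <= 1 -> 1 - n%:R * x <= (1 - x) ^+ n.
Proof.
move=> /andP[x0 x1]; elim: n => [|n IH]; first by rewrite mul0r subr0 expr0.
rewrite exprS; apply: le_trans (_ : (1 - x) * (1 - n%:R * x) <= _).
  rewrite -natr1 -subr_ge0.
  have -> : (1 - x) * (1 - n%:R * x) - (1 - (n%:R + 1) * x) = n%:R * (x * x).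
    by ring.
  by rewrite mulr_ge0 // mulr_ge0.
by apply: ler_wpM2l; rewrite // subr_ge0.
Qed.

(** With [x = 1 / (2 (n + 1))], Bernoulli's inequality for [1 - x] suffices. *)
Lemma slow_decay (R : realType) n :
  exists2 lam : R, 0 < lam < 1 & 2^-1 <= lam ^+ n.
Proof.
pose x : R := 2^-1 / n.+1%:R.
have x0 : 0 < x by rewrite divr_gt0 ?invr_gt0 ?ltr0n.
have nx : n.+1%:R * x = 2^-1 by rewrite mulrC divfK // pnatr_eq0.
have xh : x <= 2^-1 by rewrite ler_pdivrMr ?ltr0n // ler_peMr ?ler1n // invr_ge0.
have h1 : 2^-1 < 1 :> R by rewrite invf_lt1 ?ltr1n.
exists (1 - x); first by rewrite subr_gt0 gtrBl x0 andbT (le_lt_trans xh).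
apply: le_trans (bernoulli_ineq n _); last by rewrite ltW //= (le_trans xh) ?ltW.
have : n%:R * x <= 2^-1 by rewrite -nx ler_wpM2r ?ler_nat // ltW.
lra.
Qed.

Section FloydMap.
Context {R : realType} {G : groupType} {S : set G} {V : choiceType}.
Context {Gam : simple_graph V} {a : graph_action G Gam}.
Hypotheses (Sfin : finite_set S) (Sgen : generates S).
Hypothesis a_rh : relatively_hyperbolic_action a.
Variable v : V.
Local Notation cuts := (cuts Gam).
Local Notation wlen := (gdist (cayley_graph S) 1%g).
Implicit Types (e : set V) (g h t : G) (x y z : V).
Let conn := rh_connected a_rh.

Lemma edge_representatives : exists Rep : set (set V),
  [/\ finite_set Rep, Rep `<=` edges Gam &
    forall e, edges Gam e -> exists t e0, Rep e0 /\ e = a t @` e0].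
Proof.
have [_ [_ fin _]] := a_rh.
pose orb e := [set a g @` e | g in [set: G]].
have orb_self e : orb e e by exists 1%g; rewrite ?image_act1.
pose rep o := xget set0 [set e | edges Gam e /\ orb e = o].
have repP e : edges Gam e ->
    edges Gam (rep (orb e)) /\ orb (rep (orb e)) = orb e.
  move=> ee.
  apply: (@xgetPex _ set0 [set e' | edges Gam e' /\ orb e' = orb e]).
  by exists e.
exists (rep @` (orb @` edges Gam)); split; first exact: finite_image.
  by move=> _ [_ [e ee <-] <-]; case: (repP e ee).
move=> e ee; have [_ oE] := repP e ee.
have := orb_self e; rewrite -oE => -[t _ tE].
by exists t, (rep (orb e)); split => //; exists (orb e) => //; exists e.
Qed.

(** An edge [e] is measured by the word length of an element that moves a
    representative of its orbit to [e]. *)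
Definition reached (Rep : set (set V)) e m :=
  exists t e0, [/\ Rep e0, e = a t @` e0 & (wlen t <= m)%N].

Section Representatives.
Variable Rep : set (set V).
Hypotheses (Repfin : finite_set Rep) (Rep_edges : Rep `<=` edges Gam).
Hypothesis RepP : forall e, edges Gam e -> exists t e0, Rep e0 /\ e = a t @` e0.

Lemma reached_exists e : edges Gam e -> exists m, reached Rep e m.
Proof. by move=> /RepP[t [e0 [re ->]]]; exists (wlen t), t, e0. Qed.

(** As [cuts_triangle] is equivariant and there are finitely many orbits of edges,
    the new edge is obtained by moving a bounded distance in the group. *)
Lemma reached_triangle : exists C, forall e m x y z,
  reached Rep e m -> cuts e x y ->
  exists2 e', reached Rep e' (m + C) & cuts e' x z \/ cuts e' z y.
Proof.
have [|e0 /Rep_edges/(rh_cuts_triangle a_rh)[F [Ffin Fe tri]]|C hC] :=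
  @finite_bound _ Rep (fun e n => forall x y z, cuts e x y ->
     exists2 e', reached Rep e' n & cuts e' x z \/ cuts e' z y) Repfin.
- move=> e m n mn h x y z /h-/(_ z)[e' [t [e0 [re e'E lt]]] c]; exists e' => //.
  by exists t, e0; split => //; exact: leq_trans mn.
- have [|f /Fe/reached_exists//|n hn] := @finite_bound _ F (reached Rep) Ffin.
    move=> e m n mn [t [e1 [re eE lt]]]; exists t, e1; split => //.
    exact: leq_trans mn.
  by exists n => x y z /tri-/(_ z)[f Ff c]; exists f => //; exact: hn.
exists C => _ m x y z [t [e0 [re -> lt]]] c.
have := cuts_actV (a := a) (g := t) (x := a t^-1%g x) (y := a t^-1%g y)
  (e := a t @` e0).
rewrite !actKV image_actM mulVg image_act1 => /(_ c) /(hC _ re _ _ (a t^-1%g z)).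
move=> [e' [t' [e1 [re1 -> lt']]] c']; exists (a (t * t')%g @` e1).
  exists (t * t')%g, e1; split => //; apply: leq_trans (wlen_mul Sgen _ _) _.
  exact: leq_add.
by rewrite -image_actM; case: c' => /(cuts_act a t); rewrite !actKV; [left|right].
Qed.

(** Only finitely many translates of an edge cut the two ends of the image of a
    given edge of the Cayley graph. *)
Lemma reached_step : exists C, forall e m g h, reached Rep e m ->
  cayley_graph S g h -> cuts e (a g v) (a h v) ->
  (minn (wlen g) (wlen h) <= m + C)%N.
Proof.
have [|e0 re|C hC] := @finite_bound _ Rep (fun e n => forall s k, S s ->
    cuts e (a k v) (a (k * s)%g v) -> (wlen k <= n)%N) Repfin.
- by move=> e m n mn h s k Ss /(h s k Ss) le; exact: leq_trans mn.
- have [|s Ss|n hn] := @finite_bound _ S (fun s n => forall k,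
      cuts e0 (a k v) (a (k * s)%g v) -> (wlen k <= n)%N) Sfin.
  + by move=> s m n mn h k /h le; exact: leq_trans mn.
  + have [|k kc|n hn] := @finite_bound _ _ (fun k n => wlen k <= n)%N
        (finite_cuts_act a_rh e0 v (a s v)).
    * by move=> k m n mn le; exact: leq_trans mn.
    * by exists (wlen k).
    * by exists n => k; rewrite actM => /hn.
  + by exists n => s k Ss; exact: hn.
have step e m g s : reached Rep e m -> S s ->
    cuts e (a g v) (a (g * s)%g v) -> (wlen g <= m + C)%N.
  move=> [t [e0 [re -> lt]]] Ss c.
  have := cuts_actV (a := a) (g := t) (x := a (t^-1 * g)%g v)
    (y := a (t^-1 * g * s)%g v) (e := a t @` e0).
  rewrite image_actM mulVg image_act1 -!actM !mulgA mulgV !mul1g.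
  move=> /(_ c)/(hC _ re _ _ Ss) le.
  have -> : g = (t * (t^-1 * g))%g by rewrite mulVKg.
  apply: leq_trans (wlen_mul Sgen _ _) _; exact: leq_add.
exists C => e m g h re /asboolP[_ [s Ss [hE|gE]]] c.
- by apply: leq_trans (geq_minl _ _) _; apply: step re Ss _; rewrite -hE.
- apply: leq_trans (geq_minr _ _) _; apply: step re Ss _; rewrite -gE.
  exact: cuts_sym c.
Qed.

(** Induction on the path. The path is cut at an edge into two parts of at most
    half its length. By the triangle property, applied twice, one of the three
    pieces is again cut, by an edge whose measure is greater by at most [C + C].
    Halving the length is compensated by the factor [lam ^+ (C + C)], which is at
    least one half. If the piece is the single edge, its length is bounded below by
    [reached_step]. *)
Lemma floyd_length_lower_bound (lam : R) C C' : 0 < lam < 1 ->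
  2^-1 <= lam ^+ (C + C) ->
  (forall e m x y z, reached Rep e m -> cuts e x y ->
    exists2 e', reached Rep e' (m + C) & cuts e' x z \/ cuts e' z y) ->
  (forall e m g h, reached Rep e m -> cayley_graph S g h ->
    cuts e (a g v) (a h v) -> (minn (wlen g) (wlen h) <= m + C')%N) ->
  forall p g h e m, walk (cayley_graph S) g h p -> reached Rep e m ->
    cuts e (a g v) (a h v) ->
    2^-1 * lam ^+ (C' + m) <= floyd_length S lam g p.
Proof.
move=> lam01 half tri step p; have /andP[lam0 /ltW lam1] := lam01.
have [n] := ubnP (size p); elim: n p => // n IH p le g h e m [gp ph] re c.
have [p0|pN0] := eqVneq p [::].
  by rewrite p0 /= in ph; rewrite ph in c; case/cuts_irr: c.
pose W := floyd_length S lam g p.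
have W0 : 0 <= W / 2 by rewrite divr_ge0 ?floyd_length_ge0.
have WE : floyd_length S lam g p <= W / 2 + W / 2 by rewrite -splitr.
have [p1 [y [p2 [pE le1 le2]]]] := floyd_length_split W0 W0 pN0 WE.
(* The bound for one of the two parts, cut by an edge of measure at most
   [m + k], gives the bound for the whole path. *)
have bound k q : 2^-1 * lam ^+ (C' + (m + k)) <= q -> (k <= C + C)%N ->
    q <= W / 2 -> 2^-1 * lam ^+ (C' + m) <= W.
  move=> h1 kC h2; have {h1 h2} := le_trans h1 h2.
  rewrite addnA exprD mulrC ler_pM2r ?invr_gt0 // => h1.
  apply: le_trans h1; rewrite mulrC; apply: ler_wpM2l.
    by rewrite exprn_ge0 // ltW.
  by apply: le_trans half _; exact: ler_wiXn2l (ltW lam0) lam1 _ _ _.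
rewrite -/W; move: gp ph le; rewrite pE cat_path last_cat size_cat /=.
move=> /and3P[gp1 uy yp2] ph; rewrite ltnS => le.
have [e1 re1 [c1|c1]] := tri _ _ _ _ (a (last g p1) v) re c.
  have lt1 : (size p1 < n)%N.
    by apply: leq_trans le; rewrite addnS ltnS leq_addr.
  have w1 : walk (cayley_graph S) g (last g p1) p1 by [].
  exact: bound (IH p1 lt1 g (last g p1) e1 _ w1 re1 c1) (leq_addr _ _) le1.
have [e2 re2 [c2|c2]] := tri _ _ _ _ (a y v) re1 c1.
  have le3 := step _ _ _ _ re2 uy c2.
  rewrite /W pE floyd_length_cat floyd_length_cons.
  apply: ler_wpDl; first exact: floyd_length_ge0.
  apply: ler_wpDr; first exact: floyd_length_ge0.
  apply: le_trans (_ : lam ^+ (m + C + C + C') <= _); last first.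
    exact: ler_wiXn2l (ltW lam0) lam1 _ _ _.
  rewrite (_ : (m + C + C + C' = C + C + (C' + m))%N); last by lia.
  by rewrite (exprD _ (C + C)) ler_wpM2r // exprn_ge0 // ltW.
rewrite -addnA in re2.
have lt2 : (size p2 < n)%N.
  by apply: leq_trans le; rewrite addnS ltnS leq_addl.
exact: bound (IH p2 lt2 y h e2 _ (conj yp2 ph) re2 c2) (leqnn _) le2.
Qed.

End Representatives.

(** If the edge [e] cuts [g v] from [h v], then [floyd_length_lower_bound] bounds
    the Floyd distance of [g] and [h] from below in terms of [e] alone. *)
Lemma floyd_uniform : exists2 lam : R, 0 < lam < 1 &
  forall E, bowditch_entourages Gam E ->
    floyd_entourages S lam [set gh | E (a gh.1 v, a gh.2 v)].
Proof.
have [Rep [Repfin Repe RepP]] := edge_representatives.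
have [C tri] := reached_triangle Repfin Repe RepP.
have [C' step] := reached_step Repfin.
have [lam lam01 half] := slow_decay R (C + C).
have /andP[lam0 _] := lam01.
exists lam => //; have FF := floyd_entourages_filter S lam.
apply: (@bowditch_entourages_ind _ _
  (fmap (fun gh => (a gh.1 v, a gh.2 v)) (floyd_entourages S lam))) => e ee.
have [m re] := reached_exists RepP ee.
exists (2^-1 * lam ^+ (C' + m)) => /=.
  by rewrite mulr_gt0 ?invr_gt0 ?exprn_gt0.
move=> [g h] /= lt; apply/(unseparatedP conn) => c.
move: lt; rewrite ltNge => /negP[]; apply: floyd_dist_le.
  exact: cayley_connected.
move=> p w.
exact: floyd_length_lower_bound lam01 half tri step p g h e m w re c.
Qed.

End FloydMap.

(** * Vietoris limits of graphs, and extension of maps to completions *)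

(** It suffices to test convergence on the subbase. *)
Lemma vietoris_cvg (X : topologicalType) (I : Type) (Phi : set_system I)
    (D : I -> closed_subset X) (C : closed_subset X) : Filter Phi ->
  (forall W, open W -> cset C `<=` W -> Phi [set i | cset (D i) `<=` W]) ->
  (forall W, open W -> cset C `&` W !=set0 ->
    Phi [set i | cset (D i) `&` W !=set0]) ->
  forall N, nbhs C N -> Phi [set i | N (D i)].
Proof.
move=> PhiF inW meetW N; rewrite nbhsE => -[W [oW WC] WN].
have [Y YD WE] := oW; move: WC; rewrite -WE => -[Z YZ ZC].
have [J JD ZE] := YD Z YZ.
have ZW : Z `<=` W by rewrite -WE => E ZE'; exists Z.
have PZ : Phi (\bigcap_(j in [set` J]) [set i | vietoris_subbase j (D i)]).
  apply: filter_bigI => j jJ; have /set_mem oj := JD j jJ.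
  move: ZC; rewrite -ZE => /(_ j jJ).
  by case: j oj {jJ} => -[] K /= oK; [exact: inW|exact: meetW].
by apply: filterS PZ => i PZi; apply/WN/ZW; rewrite -ZE => j /PZi.
Qed.

Section NorthSouth.
Context {G : groupType} {B : topologicalType}.
Hypotheses (B_hausdorff : hausdorff_space B) (B_compact : compact [set: B]).
Variable act : G -> B -> B.
Hypothesis act_cont : forall g, continuous (act g).
Hypothesis act_surj : forall g y, exists x, act g x = y.
Variables (Phi : set_system G) (r b : B).
Hypothesis Phi_ultra : UltraFilter Phi.
(* Along [Phi], the maps send the complement of every neighbourhood of [r] close
   to [b]. *)
Hypothesis dyn : forall N M, nbhs r N -> nbhs b M ->
  Phi [set g | forall x, N x \/ M (act g x)].
Hypothesis r_nonisolated : forall N, nbhs r N -> exists2 x, N x & x <> r.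
Let cross := [set r] `*` setT `|` setT `*` [set b].
Let graph g := [set xy : B * B | xy.2 = act g xy.1].

Let separate (x y : B) : x <> y -> exists N M,
  [/\ nbhs x N, nbhs y M & forall z, N z -> M z -> False].
Proof.
move=> xy; apply: contrapT => h; apply: xy; apply: B_hausdorff => N M xN yM.
apply: contrapT => NM; apply: h; exists N, M; split=> // z Nz Mz.
by apply: NM; exists z.
Qed.

Lemma nbhs_pair (x y : B) (W : set (B * B)) : nbhs (x, y) W ->
  exists N M, [/\ nbhs x N, nbhs y M & N `*` M `<=` W].
Proof. by move=> [[N M] [/= xN yM] NMW]; exists N, M. Qed.

Lemma closed_cross : closed cross.
Proof.
have closed1 x : closed [set x : B].
  exact/accessible_closed_set1/hausdorff_accessible.
apply: closedU.
  have -> : [set r] `*` setT = fst @^-1` [set r] :> set (B * B).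
    by apply/seteqP; split=> -[x y] //= [].
  by apply: closed_comp => // -[x y] _; exact: cvg_fst.
have -> : setT `*` [set b] = snd @^-1` [set b] :> set (B * B).
  by apply/seteqP; split=> -[x y] //= [].
by apply: closed_comp => // -[x y] _; exact: cvg_snd.
Qed.

Lemma closed_graph g : closed (graph g).
Proof.
move=> [x y] cl; apply: contrapT => /= /separate[N [M [yN xM NM]]].
have xM' : nbhs x (act g @^-1` M) by exact: act_cont.
have /cl[[x' y'] [yE [/= Mx Ny]]] : nbhs (x, y) ((act g @^-1` M) `*` N).
  by exists (act g @^-1` M, N).
by apply: NM Ny _; rewrite -[y']/((x', y').2) yE.
Qed.

(** Otherwise almost every graph has a point outside [W]. Let [(x, y)] be the limit
    of these points along the ultrafilter. It is not on the cross, so [x <> r] and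
    [y <> b], which contradicts the dynamics. *)
Lemma graphs_inside W : open W -> cross `<=` W -> Phi [set g | graph g `<=` W].
Proof.
move=> oW crossW.
have [//|nW] := in_ultra_setVsetC [set g | graph g `<=` W] Phi_ultra.
have [g|X HX] :=
  @choice G B (fun g x => (exists x, ~ W (x, act g x)) -> ~ W (x, act g x)).
  have [[x Wx]|no] := pselect (exists x, ~ W (x, act g x)); first by exists x.
  by exists r => /no.
have cptE := B_compact; rewrite compact_ultra in cptE.
have [x [_ Xx]] := cptE _ (fmap_ultra X Phi_ultra) (filterT).
have [y [_ Yy]] := cptE _ (fmap_ultra (fun g => act g (X g)) Phi_ultra) (filterT).
have PX N : nbhs x N -> Phi [set g | N (X g)] by exact: Xx.
have PY N : nbhs y N -> Phi [set g | N (act g (X g))] by exact: Yy.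
have [Wxy|nWxy] := pselect (W (x, y)).
  have [N [M [xN yM NMW]]] := nbhs_pair (open_nbhs_nbhs (conj oW Wxy)).
  have /filter_ex[g [[/= ng Ng] Mg]] : Phi (~` [set g | graph g `<=` W] `&`
      [set g | N (X g)] `&` [set g | M (act g (X g))]).
    by apply: filterI (PY _ yM); exact: filterI nW (PX _ xN).
  case: (HX g); last exact: NMW.
  apply: contrapT => no; apply: ng => -[z t]; rewrite /graph /= => ->.
  apply: contrapT => nWz.
  by apply: no; exists z.
have [xr|xr] := pselect (x = r); first by case: nWxy; apply: crossW; left.
have [yb|yb] := pselect (y = b); first by case: nWxy; apply: crossW; right.
have [N [N' [xN rN' NN']]] := separate xr.
have [M [M' [yM bM' MM']]] := separate yb.
have /filter_ex[g [[/= Ng Mg] /(_ (X g))[N'g|M'g]]] : Phi ([set g | N (X g)] `&`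
    [set g | M (act g (X g))] `&` [set g | forall x, N' x \/ M' (act g x)]).
  by apply: filterI (dyn rN' bM'); exact: filterI (PX _ xN) (PY _ yM).
- by case: (NN' (X g)).
- by case: (MM' (act g (X g))).
Qed.

(** For a point [(x, b)] with [x <> r], the points [(x, g x)] converge to it; for
    [(r, y)] with [y <> b], the points [(g^-1 y, y)] do. The centre [(r, b)] is a limit
    of points of the first kind, because [r] is not isolated. *)
Lemma graphs_meet W : open W -> cross `&` W !=set0 ->
  Phi [set g | graph g `&` W !=set0].
Proof.
move=> oW [[x0 y0] [cxy Wxy]].
have meet_b x : x <> r -> W (x, b) -> Phi [set g | graph g `&` W !=set0].
  move=> /separate[N [N' [xN rN' NN']]] Wxb.
  have [K [M [xK bM KMW]]] := nbhs_pair (open_nbhs_nbhs (conj oW Wxb)).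
  apply: filterS (dyn rN' bM) => g /(_ x)[N'x|Mx].
    by case: (NN' x) => //; exact: nbhs_singleton.
  exists (x, act g x); split=> //; apply: KMW; split=> //=.
  exact: nbhs_singleton.
have [[x0r]|[_ /= y0b]] := cxy; last first.
  rewrite y0b in Wxy; have [x0r|x0r] := pselect (x0 = r); last exact: meet_b Wxy.
  have [K [M [xK bM KMW]]] := nbhs_pair (open_nbhs_nbhs (conj oW Wxy)).
  rewrite x0r in xK; have [x Kx xr] := r_nonisolated xK.
  by apply: (meet_b x) => //; apply: KMW; split=> //=; exact: nbhs_singleton.
move=> _; have [y0b|y0b] := pselect (y0 = b).
  rewrite /= in x0r; rewrite y0b x0r in Wxy.
  have [K [M [rK bM KMW]]] := nbhs_pair (open_nbhs_nbhs (conj oW Wxy)).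
  have [x Kx xr] := r_nonisolated rK.
  by apply: (meet_b x) => //; apply: KMW; split=> //=; exact: nbhs_singleton.
have [M [M' [yM bM' MM']]] := separate y0b.
have [K [L [xK yL KLW]]] := nbhs_pair (open_nbhs_nbhs (conj oW Wxy)).
rewrite /= in x0r; rewrite x0r in xK.
apply: filterS (dyn xK bM') => g dg; have [x xE] := act_surj g y0.
have [Kx|M'x] := dg x.
  exists (x, y0); split; first by rewrite /graph /= xE.
  by apply: KLW; split=> //=; exact: nbhs_singleton.
by case: (MM' y0); [exact: nbhs_singleton|rewrite -xE].
Qed.

Lemma north_south_limit_set : limit_set act b.
Proof.
exists r, (ClosedSubset closed_cross); split=> // N CN.
have /filter_ex[g Ng] : Phi [set g | N (ClosedSubset (@closed_graph g))].
  apply: vietoris_cvg CN => W oW; [exact: graphs_inside|exact: graphs_meet].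
by exists (ClosedSubset (@closed_graph g)); split=> //; exists g.
Qed.

End NorthSouth.

Section Extension.
Context {T1 T2 : Type} (U1 : filter_on (T1 * T1)) (U2 : filter_on (T2 * T2)).
Variables (o : T1 -> T2) (f : completion U1 -> completion U2).
Hypothesis unifU2 : is_uniformity U2.
Hypothesis o_unif : forall E, (U2 : set_system _) E ->
  (U1 : set_system _) [set xy | E (o xy.1, o xy.2)].

Lemma fmap_cauchy F : cauchy_filter U1 F -> cauchy_filter U2 (fmap o F).
Proof.
move=> [FF FU]; split=> [|E /o_unif/FU[A FA AE]]; first exact: fmap_proper_filter.
exists (o @` A); first by apply: (@filterS _ F) FA => x Ax; exists x.
by move=> [u v] /= [[x Ax <-] [y Ay <-]]; exact: (AE (x, y)).
Qed.

(** The image of a small set, thickened by a small entourage, is small and belongs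
    to the images of all points to which the small set belongs. *)
Lemma extension_continuous :
  (forall xi, pfilt (f xi) `<=` fmap o (pfilt xi)) -> continuous f.
Proof.
move=> fo; apply/continuousP => W oW.
suff : completion_open (f @^-1` W) by []; move=> xi Wfxi; have [E UE EW] := oW _ Wfxi.
have [D [UD _ Dsym DE]] := split3U unifU2 UE.
exists [set xy | D (o xy.1, o xy.2)]; first exact: o_unif.
move=> eta [A [xiA etaA AD]]; apply: EW; exists (entourage_ball D (o @` A)); split.
- apply: limit_ball (fo xi) UD _.
    exact: fmap_proper_filter (pfilt_proper xi).
  have pxi := pfilt_proper xi.
  by apply: (@filterS _ (pfilt xi)) xiA => x Ax; exists x.
- apply: limit_ball (fo eta) UD _.
    exact: fmap_proper_filter (pfilt_proper eta).
  have peta := pfilt_proper eta.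
  by apply: (@filterS _ (pfilt eta)) etaA => x Ax; exists x.
move=> [y y'] [/= [_ [x Ax <-] xy] [_ [x' Ax' <-] xy']].
by apply: (DE y (o x) (o x') y') => //; [exact: Dsym|exact: (AD (x, x'))].
Qed.

End Extension.

(** * Limit points of the Bowditch completion *)

Section BowditchLimit.
Context {G : groupType} {V : choiceType} {Gam : simple_graph V}.
Variable a : graph_action G Gam.
Hypothesis a_rh : relatively_hyperbolic_action a.
Local Notation ent := (bowditch_entourages Gam).
Let U : filter_on (V * V) := FilterType ent (bowditch_entourages_filter Gam).
Let unifU : is_uniformity U := bowditch_uniformity a_rh.
Local Notation close := (@completion_close _ U).
Implicit Types (xi eta : completion U) (g : G) (x y : V).

(** The image of [x] in the completion: all members of its filter are
    neighbourhoods of [x]. *)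
Lemma vertex_point x : exists xi : completion U, forall A, pfilt xi A -> A x.
Proof.
pose F : set_system V := [set A | A x].
have FF : ProperFilter F.
  apply: Build_ProperFilter_ex => [A Ax|]; first by exists x.
  by split=> [//|A B Ax Bx|A B AB]; [split|exact: AB].
have FC : cauchy_filter U F.
  split=> // E UE; exists [set x] => //.
  by move=> [_ _] [/= -> ->]; exact: (is_uniformity_diag unifU).
by have [xi xiF] := cauchy_limit unifU FC; exists xi.
Qed.

Lemma bowditch_act_continuous g :
  continuous (bowditch_act a g : completion U -> completion U).
Proof.
apply: (@extension_continuous _ _ U U (a g) (bowditch_act a g) unifU).
  exact: bowditch_uniform_action.
by move=> xi A.
Qed.

Lemma bowditch_actKV g xi : bowditch_act a g (bowditch_act a g^-1%g xi) = xi.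
Proof.
apply: completion_eq; apply/funext => A; rewrite /= /fmap /=; congr (pfilt xi _).
by apply/seteqP; split=> x; rewrite /preimage /= actKV.
Qed.

Lemma bowditch_compact : compact [set: completion U].
Proof.
by apply: completion_compact unifU _ => F; exact: (bowditch_ultra_cauchy a_rh).
Qed.

Section Limit.
Variables (Phi : set_system G) (v : V) (b r : completion U).
Hypothesis Phi_ultra : UltraFilter Phi.
Hypothesis Phi_free : forall A, finite_set A -> Phi (~` A).
Hypothesis bP : pfilt b `<=` fmap (fun g => a g v) Phi.
Hypothesis rP : pfilt r `<=` fmap (fun g => a g^-1%g v) Phi.
Let PhiF : ProperFilter Phi := ultra_proper.
#[local] Existing Instance PhiF.

(** [escaping_dynamics] for vertices passes to the completion through a vertex [x]
    that belongs to small members of [xi]. *)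
Lemma bowditch_dynamics (N M : set (completion U)) : nbhs r N -> nbhs b M ->
  Phi [set g | forall xi, N xi \/ M (bowditch_act a g xi)].
Proof.
move=> /(completion_nbhs unifU)[E UE EN] /(completion_nbhs unifU)[E' UE' E'M].
have [D [UD DE Dsym D3]] := split3U unifU UE.
have [D' [UD' D'E' D'sym D'3]] := split3U unifU UE'.
have [A rA AD] := pfilt_cauchy r UD; have [A' bA' A'D'] := pfilt_cauchy b UD'.
have PA : Phi [set g | A (a g^-1%g v)] := rP rA.
have PA' : Phi [set g | A' (a g v)] := bP bA'.
have Pdyn := escaping_dynamics a_rh PhiF Phi_free v UD UD'.
apply: filterS (filterI (filterI PA PA') Pdyn) => g [[/= Ag A'g] dyn] xi.
have UgD' := bowditch_uniform_action a g UD'.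
have [C xiC CD] := pfilt_cauchy xi UD.
have [C' xiC' C'D'] := pfilt_cauchy xi UgD'.
have pxi := pfilt_proper xi.
have /filter_ex[x [Cx C'x]] : pfilt xi (C `&` C') by exact: filterI.
have [xD|xD'] := dyn x.
  left; apply: EN; apply: close_sym.
  exact: close_bridge DE Dsym D3 xiC rA CD AD Cx Ag xD.
right; apply: E'M; apply: close_sym.
have gxiC' : pfilt (bowditch_act a g xi) (a g @` C').
  by apply: (@filterS _ (pfilt xi)) xiC' => y C'y; exists y.
apply: (close_bridge D'E' D'sym D'3 gxiC' bA' _ A'D' _ A'g xD'); last by exists x.
by move=> [_ _] [/= [y C'y <-] [z C'z <-]]; exact: (C'D' (y, z)).
Qed.

(** The points [g^-1 x] tend to [r] for every vertex [x], since [g^-1 x] and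
    [g^-1 v] become close. For two vertices [x <> y], at most one of [g^-1 x] and
    [g^-1 y] is equal to [r]. *)
Lemma repelling_nonisolated (N : set (completion U)) : nbhs r N ->
  exists2 xi, N xi & xi <> r.
Proof.
move=> /(completion_nbhs unifU)[E UE EN].
have [D [UD DE Dsym D3]] := split3U unifU UE.
have [A rA AD] := pfilt_cauchy r UD.
have near x xi g : (forall B, pfilt xi B -> B (a g^-1%g x)) ->
    A (a g^-1%g v) -> D (a g^-1%g v, a g^-1%g x) -> N xi.
  move=> xiP Ag Dg; apply: EN; have [C xiC CD] := pfilt_cauchy xi UD.
  exact: close_bridge DE Dsym D3 rA xiC AD CD Ag (xiP _ xiC) Dg.
have PA : Phi [set g | A (a g^-1%g v)] := rP rA.
have PhiV_free B : finite_set B -> fmap (fun g => g^-1%g) Phi (~` B).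
  move=> Bfin; apply: (@filterS _ Phi) (Phi_free (finite_image (fun g => g^-1%g) Bfin)).
  by move=> g nBg Bg; apply: nBg; exists g^-1%g; rewrite ?invgK.
have PD x : Phi [set g | D (a g^-1%g v, a g^-1%g x)].
  exact: (escaping_orbits a_rh _ PhiV_free v x UD).
have [x [y xy]] := rh_nontrivial a_rh.
have /filter_ex[g [[/= Ag Dx] Dy]] : Phi ([set g | A (a g^-1%g v)] `&`
    [set g | D (a g^-1%g v, a g^-1%g x)] `&` [set g | D (a g^-1%g v, a g^-1%g y)]).
  by apply: filterI (PD y); exact: filterI (PD x).
have [xi xiP] := vertex_point (a g^-1%g x).
have [eta etaP] := vertex_point (a g^-1%g y).
have [xir|xir] := pselect (xi = r); last by exists xi => //; exact: near xiP Ag Dx.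
exists eta => [|etar]; first exact: near etaP Ag Dy.
have [|E' UE'] := bowditch_separated a_rh (x := a g^-1%g x) (y := a g^-1%g y).
  by move=> /(can_inj (actK a g^-1%g)).
have [C rC CE'] := pfilt_cauchy r (UE' : (U : set_system _) E'); apply.
by apply: (CE' (_, _)); split; [apply: xiP; rewrite xir|apply: etaP; rewrite etar].
Qed.

End Limit.

(** An ultrafilter that leaves every finite subset of [G] makes the graphs of
    the maps [a g] converge to the cross of the limits of [g^-1 v] and [g v]. *)
Lemma bowditch_boundary_limit (Phi : set_system G) v (b : completion U) :
  UltraFilter Phi -> (forall A, finite_set A -> Phi (~` A)) ->
  pfilt b `<=` fmap (fun g => a g v) Phi -> bowditch_boundary a b.
Proof.
move=> PhiU Phi_free bP.
have [r rP] := cauchy_limit unifU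
  (bowditch_ultra_cauchy a_rh (fmap_ultra (fun g => a g^-1%g v) PhiU)).
apply: (@north_south_limit_set G (completion U) (completion_hausdorff unifU)
  bowditch_compact (bowditch_act a) bowditch_act_continuous _ Phi r b PhiU).
- by move=> g y; exists (bowditch_act a g^-1%g y); exact: bowditch_actKV.
- by move=> N M rN bM; exact: bowditch_dynamics Phi_free bP rP N M rN bM.
- by move=> N rN; exact: repelling_nonisolated Phi_free rP N rN.
Qed.

End BowditchLimit.

Unset Implicit Arguments.
Set Strict Implicit.

(** * The Floyd map *)

Theorem mainTheorem2 (R : realType) (G : groupType)
    (S : set G) (Sfin : finite_set S) (Sgen : generates S)
    (P : set (set G)) (Pfin : finite_set P)
    (Pinf : forall H : set G, P H -> group_closed [in H] /\ infinite_set H)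
    (V : choiceType) (Gam : simple_graph V) (a : graph_action G Gam)
    (a_relhyp : relatively_hyperbolic_action a)
    (a_P : peripheral_representatives a P) :
  exists (lam : R) (lam01 : 0 < lam < 1)
         (f : floyd_completion S lam -> bowditch_completion Gam),
    [/\ {within floyd_boundary S lam, continuous f},
        forall xi, floyd_boundary S lam xi -> bowditch_boundary a (f xi)
      & forall g xi, floyd_boundary S lam xi ->
          f (floyd_act Sgen lam01 g xi) = bowditch_act a g (f xi)].
Proof.
have [[v _] _] := rh_connected a_relhyp.
have [lam lam01 unif] := floyd_uniform (R := R) Sfin Sgen a_relhyp v.
have unifB := bowditch_uniformity a_relhyp.
pose UF := FilterType _ (floyd_entourages_filter S lam).
pose UB := FilterType _ (bowditch_entourages_filter Gam).
have [xi|f fP] := @choice (completion UF) (completion UB)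
    (fun xi eta => pfilt eta `<=` fmap (fun g => a g v) (pfilt xi)).
  apply: (cauchy_limit (U := UB) unifB).
  by apply: (@fmap_cauchy _ _ UF UB _ unif); have [] := pfiltP xi.
exists lam, lam01, f; split.
- apply: continuous_subspaceT.
  exact: (@extension_continuous _ _ UF UB _ f unifB unif fP).
- move=> xi bd; have xiF := pfilt_proper xi.
  have [Phi [PhiU xiPhi]] := ultraFilterLemma xiF.
  apply: (bowditch_boundary_limit a_relhyp (v := v) PhiU).
    exact: floyd_boundary_free lam01 _ _ (cayley_connected Sgen) bd PhiU xiPhi.
  by move=> A /fP; exact: xiPhi.
(* Both points are limits of the filter generated by the points [(g h) v], where
   [h] tends to [xi]. *)
- move=> g xi bd; have xiF := pfilt_proper xi.
  apply: (@limit_unique _ UB unifB (fmap (fun h => a (g * h)%g v) (pfilt xi))).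
  + by move=> A /fP.
  + move=> A /= /fP; rewrite /fmap /=; congr (pfilt xi).
    by apply/seteqP; split=> h; rewrite /preimage /= actM.
Qed.
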